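(* Let $\mathfrak{hs}_3\mathfrak{gal1}$ (respectively $\mathfrak{hs}_3\mathfrak{gal2}$) be the Lie algebra obtained from $\mathfrak{hs}_3\mathfrak{(A)dS}$ by successively applying the contraction procedures 1 and 3 (respectively 1 and 4) defined in the context. (i) With $\mathfrak{g}=\{P_a,G_a,P_{ab},G_{ab}\}$, $\mathfrak{h}=\{H,J,H_a,J_a\}$ and $\langle P_a,G_b\rangle_{\mathfrak{g}}=\delta_{ab}$, $\langle P_{ab},G_{cd}\rangle_{\mathfrak{g}}=\delta_{a(c}\delta_{d)b}-\frac23\delta_{ab}\delta_{cd}$, the algebra $\mathfrak{hs}_3\mathfrak{gal1}$ fulfils the assumptions of the Medina--Revoy double extension theorem stated in the context. Denoting the generators of $\mathfrak{h}^*$ by $\{H^*,J^*,H^*_a,J^*_a\}$, the resulting double extension $\mathfrak{hs}_3\mathfrak{ebarg1}$ has the non-zero commutators $[J,G_a]=\epsilon_{am}G_m$, $[J,P_a]=\epsilon_{am}P_m$, $[G_a,H]=-\epsilon_{am}P_m$, $[G_a,G_b]=\epsilon_{ab}H^*$, $[P_a,G_b]=\epsilon_{ab}J^*$; $[J,J_a]=\epsilon_{am}J_m$, $[J,G_{ab}]=-\epsilon_{m(a}G_{b)m}$, $[J,H_a]=\epsilon_{am}H_m$, $[J,P_{ab}]=-\epsilon_{m(a}P_{b)m}$, $[G_a,J_b]=-(\epsilon_{am}G_{bm}+\epsilon_{ab}G_{mm})$, $[G_a,H_b]=-(\epsilon_{am}P_{bm}+\epsilon_{ab}P_{mm})$,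 $[H,J_a]=\epsilon_{am}H_m$, $[H,G_{ab}]=-\epsilon_{m(a}P_{b)m}$, $[P_a,J_b]=-(\epsilon_{am}P_{bm}+\epsilon_{ab}P_{mm})$; $[J_a,J_b]=\epsilon_{ab}J$, $[J_a,G_{bc}]=\delta_{a(b}\epsilon_{c)m}G_m$, $[J_a,H_b]=\epsilon_{ab}H$, $[J_a,P_{bc}]=\delta_{a(b}\epsilon_{c)m}P_m$, $[G_{ab},H_c]=-\delta_{c(a}\epsilon_{b)m}P_m$; $[G_{ab},G_{cd}]=\epsilon_{(a(c}\delta_{d)b)}H^*$, $[P_{ab},G_{cd}]=\epsilon_{(a(c}\delta_{d)b)}J^*$, $[P_a,G_{bc}]=\epsilon_{a(b}J^*_{c)}$, $[G_a,G_{bc}]=\epsilon_{a(b}H^*_{c)}$, $[G_a,P_{bc}]=\epsilon_{a(b}J^*_{c)}$; $[J,H^*_a]=\epsilon_{am}H^*_m$, $[J,J^*_a]=\epsilon_{am}J^*_m$, $[H,H^*_a]=\epsilon_{am}J^*_m$, $[J_a,J^*]=-\epsilon_{am}J^*_m$, $[J_a,H^*]=-\epsilon_{am}H^*_m$, $[J_a,J^*_b]=\epsilon_{ab}J^*$, $[J_a,H^*_b]=\epsilon_{ab}H^*$, $[H_a,H^*]=-\epsilon_{am}J^*_m$, $[H_a,H^*_b]=\epsilon_{ab}J^*$, and it admits the invariant metric with non-zero components $\langle P_a,G_b\rangle=\delta_{ab}$, $\langle P_{ab},G_{cd}\rangle=\delta_{a(c}\delta_{d)b}-\frac23\delta_{ab}\delta_{cd}$,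 $\langle H,H^*\rangle=1$, $\langle J,J^*\rangle=1$, $\langle H_a,H^*_b\rangle=\delta_{ab}$, $\langle J_a,J^*_b\rangle=\delta_{ab}$. (ii) With $\mathfrak{g}=\{P_a,G_a,H_a,J_a\}$, $\mathfrak{h}=\{H,J,P_{ab},G_{ab}\}$ and $\langle P_a,G_b\rangle_{\mathfrak{g}}=\delta_{ab}$, $\langle H_a,J_b\rangle_{\mathfrak{g}}=-\delta_{ab}$, the double extension theorem applies likewise to $\mathfrak{hs}_3\mathfrak{gal2}$. Denoting the generators of $\mathfrak{h}^*$ by $\{H^*,J^*,P^*_{ab},G^*_{ab}\}$, the resulting double extension $\mathfrak{hs}_3\mathfrak{ebarg2}$ has the non-zero commutators $[J,G_a]=\epsilon_{am}G_m$, $[J,P_a]=\epsilon_{am}P_m$, $[G_a,H]=-\epsilon_{am}P_m$, $[G_a,G_b]=\epsilon_{ab}H^*$, $[G_a,P_b]=\epsilon_{ab}J^*$; $[J,J_a]=\epsilon_{am}J_m$, $[J,G_{ab}]=-\epsilon_{m(a}G_{b)m}$, $[J,H_a]=\epsilon_{am}H_m$, $[J,P_{ab}]=-\epsilon_{m(a}P_{b)m}$, $[G_a,G_{bc}]=-\epsilon_{a(b}J_{c)}$, $[G_a,P_{bc}]=-\epsilon_{a(b}H_{c)}$, $[H,J_a]=\epsilon_{am}H_m$, $[H,G_{ab}]=-\epsilon_{m(a}P_{b)m}$, $[P_a,G_{bc}]=-\epsilon_{a(b}H_{c)}$; $[J_a,G_{bc}]=\delta_{a(b}\epsilon_{c)m}G_m$,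 $[J_a,P_{bc}]=\delta_{a(b}\epsilon_{c)m}P_m$, $[G_{ab},G_{cd}]=\delta_{(a(c}\epsilon_{d)b)}J$, $[G_{ab},H_c]=-\delta_{c(a}\epsilon_{b)m}P_m$, $[G_{ab},P_{cd}]=\delta_{(a(c}\epsilon_{d)b)}H$; $[G_a,J_b]=-\epsilon_{am}P^*_{mb}$, $[G_a,H_b]=-\epsilon_{am}G^*_{mb}$, $[P_a,J_b]=-\epsilon_{am}G^*_{mb}$, $[J_a,J_b]=-\epsilon_{ab}H^*$, $[J_a,H_b]=-\epsilon_{ab}J^*$; $[J,P^*_{ab}]=-\epsilon_{m(a}P^*_{b)m}$, $[J,G^*_{ab}]=-\epsilon_{m(a}G^*_{b)m}$, $[H,P^*_{ab}]=-\epsilon_{m(a}G^*_{b)m}$, $[G_{ab},J^*]=-\epsilon_{m(a}G^*_{b)m}$, $[G_{ab},H^*]=-\epsilon_{m(a}P^*_{b)m}$, $[G_{ab},G^*_{cd}]=\epsilon_{(a(c}\delta_{d)b)}J^*$, $[G_{ab},P^*_{cd}]=\epsilon_{(a(c}\delta_{d)b)}H^*$, $[P_{ab},H^*]=-\epsilon_{m(a}G^*_{b)m}$, $[P_{ab},P^*_{cd}]=\epsilon_{(a(c}\delta_{d)b)}J^*$, and it admits the invariant metric with non-zero components $\langle P_a,G_b\rangle=\delta_{ab}$, $\langle H_a,J_b\rangle=-\delta_{ab}$, $\langle H,H^*\rangle=1$, $\langle J,J^*\rangle=1$, $\langle P_{ab},P^*_{cd}\rangle=\delta_{a(c}\delta_{d)b}$,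 $\langle G_{ab},G^*_{cd}\rangle=\delta_{a(c}\delta_{d)b}$. (iii) For both $\mathfrak{hs}_3\mathfrak{ebarg1}$ and $\mathfrak{hs}_3\mathfrak{ebarg2}$ the generators $\{H,J,P_a,G_a,H^*,J^*\}$ form a subalgebra that coincides with the Extended Bargmann algebra (the extension of the three-dimensional Galilei algebra $\{H,J,P_a,G_a\}$ by the two central elements $H^*,J^*$ given by the first line of brackets in (i)).
   Context: Conventions. Indices $A,B,\dots\in\{0,1,2\}$, $a,b,m,\dots\in\{1,2\}$; repeated indices are summed; $\eta=\mathrm{diag}(-1,1,1)$ raises and lowers indices; $\epsilon_{ABC}$ is totally antisymmetric with $\epsilon_{012}=1$, and $\epsilon_{ab}=\epsilon_{0ab}$. Symmetrization has no normalization factor, $T_{(ab)}=T_{ab}+T_{ba}$, and nested symmetrizations are taken from the outermost to the innermost, e.g. $T_{(a(cd)b)}=T_{acdb}+T_{adcb}+T_{bcda}+T_{bdca}$. An invariant metric is a nondegenerate ad-invariant symmetric bilinear form. Braces denote the linear span; listing $G_a$, $G_{ab}$, etc. means all components. $G_{ab},P_{ab},G^*_{ab},P^*_{ab}$ are symmetric in $a,b$. $\mathfrak{hs}_3\mathfrak{(A)dS}$: the 16-dimensional real Lie algebra spanned by $\hat J_A,\hat P_A,\hat J_{AB},\hat P_{AB}$, with $\hat J_{AB}=\hat J_{BA}$, $\hat P_{AB}=\hat P_{BA}$, $\eta^{AB}\hat J_{AB}=\eta^{AB}\hat P_{AB}=0$, and brackets (upper sign AdS, lower sign dS) $[\hat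 J_A,\hat J_B]=\epsilon_{ABC}\hat J^C$, $[\hat J_A,\hat P_B]=\epsilon_{ABC}\hat P^C$, $[\hat P_A,\hat P_B]=\pm\epsilon_{ABC}\hat J^C$, $[\hat J_A,\hat J_{BC}]=\epsilon^M{}_{A(B}\hat J_{C)M}$, $[\hat J_A,\hat P_{BC}]=[\hat P_A,\hat J_{BC}]=\epsilon^M{}_{A(B}\hat P_{C)M}$, $[\hat P_A,\hat P_{BC}]=\pm\epsilon^M{}_{A(B}\hat J_{C)M}$, $[\hat J_{AB},\hat J_{CD}]=-\eta_{(A(C}\epsilon_{D)B)M}\hat J^M$, $[\hat J_{AB},\hat P_{CD}]=-\eta_{(A(C}\epsilon_{D)B)M}\hat P^M$, $[\hat P_{AB},\hat P_{CD}]=\mp\eta_{(A(C}\epsilon_{D)B)M}\hat J^M$. Basis. $J=\hat J_0$, $G_a=\hat J_a$, $H=\hat P_0$, $P_a=\hat P_a$, $J_a=\hat J_{0a}$, $G_{ab}=\hat J_{ab}$, $H_a=\hat P_{0a}$, $P_{ab}=\hat P_{ab}$, with $\hat J_{00}=G_{11}+G_{22}$, $\hat P_{00}=P_{11}+P_{22}$ by tracelessness. Contraction procedure for a decomposition $\mathfrak{k}=\mathfrak{h}+\mathfrak{i}$ with $\mathfrak{h}$ a subalgebra: the new Lie algebra on the same vector space in which brackets $[\mathfrak{h},\mathfrak{h}]$ are unchanged, brackets $[\mathfrak{h},\mathfrak{i}]$ are replaced by their $\mathfrak{i}$-component, and $[\mathfrak{i},\mathfrak{i}]=0$. Successive application means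 applying the second procedure to the Lie algebra resulting from the first. Procedure 1: $\mathfrak{h}=\{J,G_a,J_a,G_{ab}\}$, $\mathfrak{i}=\{H,P_a,H_a,P_{ab}\}$. Procedure 3: $\mathfrak{h}=\{J,H,J_a,H_a\}$, $\mathfrak{i}=\{G_a,P_a,G_{ab},P_{ab}\}$. Procedure 4: $\mathfrak{h}=\{J,H,G_{ab},P_{ab}\}$, $\mathfrak{i}=\{G_a,P_a,J_a,H_a\}$. The results are the same starting from AdS or dS. Double extension (Medina--Revoy). Assumptions: a Lie algebra that is a semidirect sum of Lie algebras $\mathfrak{g}$ (generators $X_i$) and $\mathfrak{h}$ (generators $Y_\alpha$), $[X_i,X_j]=f_{ij}{}^kX_k$, $[Y_\alpha,X_i]=f_{\alpha i}{}^jX_j$, $[Y_\alpha,Y_\beta]=f_{\alpha\beta}{}^\gamma Y_\gamma$, and an invariant metric $g_{ij}=\langle X_i,X_j\rangle_{\mathfrak{g}}$ on $\mathfrak{g}$ that is left invariant by the action of $\mathfrak{h}$ on $\mathfrak{g}$. Conclusion: with $\mathfrak{h}^*$ the dual of $\mathfrak{h}$ (generators $Y^\alpha$), the vector space $\mathfrak{g}+\mathfrak{h}+\mathfrak{h}^*$ is a Lie algebra, the double extension of $\mathfrak{g}$ by $\mathfrak{h}$, with brackets $[X_i,X_j]=f_{ij}{}^kX_k+f_{\alpha i}{}^kg_{kj}Y^\alpha$, $[Y_\alpha,X_i]=f_{\alpha i}{}^jX_j$, $[Y_\alpha,Y_\beta]=f_{\alpha\beta}{}^\gamma Y_\gamma$,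 $[Y_\alpha,Y^\beta]=-f_{\alpha\gamma}{}^\beta Y^\gamma$, $[Y^\alpha,X_i]=[Y^\alpha,Y^\beta]=0$, admitting an invariant metric with non-zero components $\langle X_i,X_j\rangle=g_{ij}$, $\langle Y_\alpha,Y_\beta\rangle=h_{\alpha\beta}$, $\langle Y_\alpha,Y^\beta\rangle=\delta_\alpha^\beta$, where $h_{\alpha\beta}$ is a possibly degenerate (here zero) symmetric invariant bilinear form on $\mathfrak{h}$. The starred generators in the claim are the generators of $\mathfrak{h}^*$, normalized by the pairings with $\mathfrak{h}$ listed in the invariant metrics. *)

(* Defs.v *)
From HB Require Import structures.
From mathcomp Require Import all_boot all_order all_algebra.
From mathcomp Require Import reals ring lra.

Set Implicit Arguments.
Unset Strict Implicit.
Unset Printing Implicit Defensive.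

Import GRing.Theory Num.Theory.
Local Open Scope ring_scope.

(* Lie algebras are vector spaces with a bracket satisfying [is_lie]; R is an
   arbitrary field here and the real numbers in the theorem. *)
Section LieAlgebras.
Variable R : fieldType.

Definition is_lie (L : lmodType R) (br : L -> L -> L) : Prop :=
  [/\ forall x, linear (br x),
      forall y, linear (br ^~ y),
      forall x, br x x = 0
    & forall x y z, br x (br y z) + br y (br z x) + br z (br x y) = 0].

Definition invariant_metric (L : lmodType R) (br : L -> L -> L)
    (B : L -> L -> R) : Prop :=
  [/\ forall x, scalar (B x),
      forall x y, B x y = B y x,
      forall x, (forall y, B x y = 0) -> x = 0
    & forall x y z, B (br z x) y + B x (br z y) = 0].

Variables (V : vectType R) (br : V -> V -> V).

Definition subalgebra (U : {vspace V}) : Prop :=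
  {in U &, forall x y, br x y \in U}.

(* The bracket of the subalgebra U; [vsproj U] is the inverse of [vsval] on U,
   so this is meaningful only if [subalgebra U]. *)
Definition sub_br (U : {vspace V}) (x y : subvs_of U) : subvs_of U :=
  vsproj U (br (vsval x) (vsval y)).

Definition direct_decomposition (U W : {vspace V}) : Prop :=
  (U + W = fullv)%VS /\ (U :&: W = 0)%VS.

Definition contractible (h i : {vspace V}) : Prop :=
  direct_decomposition h i /\ subalgebra h.

(* [daddv_pi U W] is the projection onto U along W. *)
Definition contraction (h i : {vspace V}) (x y : V) : V :=
  let ph := daddv_pi h i in
  let pi := daddv_pi i h in
  br (ph x) (ph y) + pi (br (ph x) (pi y)) + pi (br (pi x) (ph y)).

Definition semidirect_sum (g h : {vspace V}) : Prop :=
  [/\ direct_decomposition g h, subalgebra g, subalgebra h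
    & {in h & g, forall y x, br y x \in g}].

Record double_extension_assumptions (g h : {vspace V})
    (B : subvs_of g -> subvs_of g -> R) : Prop := DoubleExtensionAssumptions {
  dea_lie : is_lie br;
  dea_semidirect : semidirect_sum g h;
  dea_metric : invariant_metric (@sub_br g) B;
  dea_action : forall (y : subvs_of h) (x x' : subvs_of g),
    B (vsproj g (br (vsval y) (vsval x))) x' +
    B x (vsproj g (br (vsval y) (vsval x'))) = 0 }.

Definition dualv (h : {vspace V}) : vectType R := 'Hom(subvs_of h, R^o).

(* The vector space g + h + h*. *)
Definition dext (g h : {vspace V}) : vectType R :=
  (subvs_of g * subvs_of h * dualv h)%type.

(* Coordinate-free form of the brackets of the double extension: in terms of a
   basis Y_alpha of h with dual basis Y^alpha,
     f_{alpha i}^k g_{kj} Y^alpha is Y |-> <[Y, X_i], X_j>, and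
     [Y_alpha, Y^beta] = - f_{alpha gamma}^beta Y^gamma
       is Y |-> - Y^beta ([Y_alpha, Y]). *)
Definition dext_br (g h : {vspace V}) (B : subvs_of g -> subvs_of g -> R)
    (u v : dext g h) : dext g h :=
  let: (x, y, phi) := u in
  let: (x', y', phi') := v in
  (vsproj g (br (vsval x) (vsval x') + br (vsval y) (vsval x')
             - br (vsval y') (vsval x)),
   vsproj h (br (vsval y) (vsval y')),
   linfun (fun Y : subvs_of h =>
     (B (vsproj g (br (vsval Y) (vsval x))) x' : R^o)
     - phi' (vsproj h (br (vsval y) (vsval Y)))
     + phi (vsproj h (br (vsval y') (vsval Y))))).

(* The metric of the double extension with h_{alpha beta} = 0. *)
Definition dext_form (g h : {vspace V}) (B : subvs_of g -> subvs_of g -> R)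
    (u v : dext g h) : R :=
  B u.1.1 v.1.1 + v.2 u.1.2 + u.2 v.1.2.

End LieAlgebras.

Section Tensors.
Variable R : pzRingType.

Definition mink (A B : 'I_3) : R :=
  if A == B then (if A == ord0 then -1 else 1) else 0.

Definition eps3 (A B C : 'I_3) : R :=
  match val A, val B, val C with
  | 0, 1, 2 | 1, 2, 0 | 2, 0, 1 => 1
  | 0, 2, 1 | 2, 1, 0 | 1, 0, 2 => -1
  | _, _, _ => 0
  end.

(* A spatial index in {1, 2} is represented by an element of {0, 1}. *)
Definition sp (a : 'I_2) : 'I_3 := lift ord0 a.

Definition eps (a b : 'I_2) : R := eps3 ord0 (sp a) (sp b).

Definition delta (a b : 'I_2) : R := (a == b)%:R.

(* T_{(ab)} *)
Definition sym (I : Type) (W : nmodType) (T : I -> I -> W) (a b : I) : W :=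
  T a b + T b a.

(* T_{(a(cd)b)} *)
Definition nsym (I : Type) (W : nmodType) (T : I -> I -> I -> I -> W)
    (a b c d : I) : W :=
  T a c d b + T a d c b + T b c d a + T b d c a.

End Tensors.

Arguments mink {R}.
Arguments eps3 {R}.
Arguments eps {R}.
Arguments delta {R}.

Inductive cosmology := AdS | dS.

Record hatted_generators (V : Type) := HattedGenerators {
  hJ : 'I_3 -> V;
  hP : 'I_3 -> V;
  hJJ : 'I_3 -> 'I_3 -> V;
  hPP : 'I_3 -> 'I_3 -> V }.

Section HS3.
Variable R : fieldType.

Section RightHandSides.
Variable V : lmodType R.

(* X^C *)
Definition raise (X : 'I_3 -> V) (C : 'I_3) : V := \sum_D mink C D *: X D.

(* epsilon^M_{AB} *)
Definition eps_up (M A B : 'I_3) : R := \sum_N mink M N * eps3 N A B.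

(* epsilon_{ABC} X^C *)
Definition vec_vec (X : 'I_3 -> V) (A B : 'I_3) : V :=
  \sum_C eps3 A B C *: raise X C.

(* epsilon^M_{A(B} X_{C)M} *)
Definition vec_ten (X : 'I_3 -> 'I_3 -> V) (A B C : 'I_3) : V :=
  \sum_M sym (fun B C => eps_up M A B *: X C M) B C.

(* - eta_{(A(C} epsilon_{D)B)M} X^M *)
Definition ten_ten (X : 'I_3 -> V) (A B C D : 'I_3) : V :=
  - \sum_M nsym (fun A C D B => mink A C * eps3 D B M : R) A B C D *: raise X M.

End RightHandSides.

Definition sign (c : cosmology) : R := match c with AdS => 1 | dS => -1 end.

Definition hatted_seq (V : Type) (e : hatted_generators V) : seq V :=
  [seq hJ e A | A <- enum 'I_3] ++ [seq hP e A | A <- enum 'I_3] ++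
  [seq hJJ e A B | A <- enum 'I_3, B <- enum 'I_3] ++
  [seq hPP e A B | A <- enum 'I_3, B <- enum 'I_3].

(* hs_3 AdS or hs_3 dS, as a Lie algebra with distinguished generators. *)
Record is_hs3 (c : cosmology) (V : vectType R) (br : V -> V -> V)
    (e : hatted_generators V) : Prop := IsHS3 {
  hs3_lie : is_lie br;
  hs3_dim : \dim {:V} = 16%N;
  hs3_span : (<<hatted_seq e>> = fullv)%VS;
  hs3_JJC : forall A B, hJJ e A B = hJJ e B A;
  hs3_PPC : forall A B, hPP e A B = hPP e B A;
  hs3_trJJ : \sum_A \sum_B mink A B *: hJJ e A B = 0;
  hs3_trPP : \sum_A \sum_B mink A B *: hPP e A B = 0;
  hs3_J_J : forall A B, br (hJ e A) (hJ e B) = vec_vec (hJ e) A B;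
  hs3_J_P : forall A B, br (hJ e A) (hP e B) = vec_vec (hP e) A B;
  hs3_P_P : forall A B, br (hP e A) (hP e B) = sign c *: vec_vec (hJ e) A B;
  hs3_J_JJ : forall A B C, br (hJ e A) (hJJ e B C) = vec_ten (hJJ e) A B C;
  hs3_J_PP : forall A B C, br (hJ e A) (hPP e B C) = vec_ten (hPP e) A B C;
  hs3_P_JJ : forall A B C, br (hP e A) (hJJ e B C) = vec_ten (hPP e) A B C;
  hs3_P_PP : forall A B C,
    br (hP e A) (hPP e B C) = sign c *: vec_ten (hJJ e) A B C;
  hs3_JJ_JJ : forall A B C D,
    br (hJJ e A B) (hJJ e C D) = ten_ten (hJ e) A B C D;
  hs3_JJ_PP : forall A B C D,
    br (hJJ e A B) (hPP e C D) = ten_ten (hP e) A B C D;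
  hs3_PP_PP : forall A B C D,
    br (hPP e A B) (hPP e C D) = sign c *: ten_ten (hJ e) A B C D }.

End HS3.

(* Names of the generators of all the contracted and extended algebras. The
   digit is the number of spatial indices, s stands for the star: H1s a is
   H^*_a, G2s a b is G^*_{ab}. Each algebra uses only some of the names. *)
Inductive gen :=
| J | H | G1 of 'I_2 | P1 of 'I_2
| J1 of 'I_2 | H1 of 'I_2 | G2 of 'I_2 & 'I_2 | P2 of 'I_2 & 'I_2
| Hs | Js | H1s of 'I_2 | J1s of 'I_2 | G2s of 'I_2 & 'I_2 | P2s of 'I_2 & 'I_2.

Definition gens : seq gen :=
  let I := enum 'I_2 in
  [:: J; H; Hs; Js] ++
  [seq G1 a | a <- I] ++ [seq P1 a | a <- I] ++
  [seq J1 a | a <- I] ++ [seq H1 a | a <- I] ++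
  [seq J1s a | a <- I] ++ [seq H1s a | a <- I] ++
  [seq G2 a b | a <- I, b <- I] ++ [seq P2 a b | a <- I, b <- I] ++
  [seq G2s a b | a <- I, b <- I] ++ [seq P2s a b | a <- I, b <- I].

Definition h_proc1 (x : gen) : bool :=
  match x with J | G1 _ | J1 _ | G2 _ _ => true | _ => false end.
Definition i_proc1 (x : gen) : bool :=
  match x with H | P1 _ | H1 _ | P2 _ _ => true | _ => false end.

Definition h_proc3 (x : gen) : bool :=
  match x with J | H | J1 _ | H1 _ => true | _ => false end.
Definition i_proc3 (x : gen) : bool :=
  match x with G1 _ | P1 _ | G2 _ _ | P2 _ _ => true | _ => false end.

Definition h_proc4 (x : gen) : bool :=
  match x with J | H | G2 _ _ | P2 _ _ => true | _ => false end.
Definition i_proc4 (x : gen) : bool :=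
  match x with G1 _ | P1 _ | J1 _ | H1 _ => true | _ => false end.

Definition g_ebarg1 (x : gen) : bool :=
  match x with P1 _ | G1 _ | P2 _ _ | G2 _ _ => true | _ => false end.
Definition h_ebarg1 (x : gen) : bool :=
  match x with H | J | H1 _ | J1 _ => true | _ => false end.
Definition s_ebarg1 (x : gen) : bool :=
  match x with Hs | Js | H1s _ | J1s _ => true | _ => false end.

Definition g_ebarg2 (x : gen) : bool :=
  match x with P1 _ | G1 _ | H1 _ | J1 _ => true | _ => false end.
Definition h_ebarg2 (x : gen) : bool :=
  match x with H | J | P2 _ _ | G2 _ _ => true | _ => false end.
Definition s_ebarg2 (x : gen) : bool :=
  match x with Hs | Js | P2s _ _ | G2s _ _ => true | _ => false end.

Definition gen_ebarg (x : gen) : bool :=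
  match x with H | J | P1 _ | G1 _ | Hs | Js => true | _ => false end.

Section GeneratorsAndTables.
Variable R : fieldType.

Definition span_of (V : vectType R) (e : gen -> V) (p : pred gen) :
    {vspace V} :=
  <<[seq e x | x <- gens & p x]>>%VS.

Definition gen_val (V : vectType R) (e : hatted_generators V) (x : gen) : V :=
  match x with
  | J => hJ e ord0
  | H => hP e ord0
  | G1 a => hJ e (sp a)
  | P1 a => hP e (sp a)
  | J1 a => hJJ e ord0 (sp a)
  | H1 a => hPP e ord0 (sp a)
  | G2 a b => hJJ e (sp a) (sp b)
  | P2 a b => hPP e (sp a) (sp b)
  | Hs | Js | H1s _ | J1s _ | G2s _ _ | P2s _ _ => 0
  end.

Definition dext_val (V : vectType R) (e : gen -> V) (g h : {vspace V})
    (in_g in_h in_s : pred gen) (st : gen -> dualv h) (x : gen) : dext g h :=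
  if in_g x then (vsproj g (e x), 0, 0)
  else if in_h x then (0, vsproj h (e x), 0)
  else if in_s x then (0, 0, st x)
  else 0.

Section Brackets.
Variables (W : lmodType R) (br : W -> W -> W) (e : gen -> W).

(* A table lists brackets in one order of the two arguments only; a bracket
   listed in neither order vanishes. *)
Definition has_brackets (p : pred gen) (t : gen -> gen -> option W) : Prop :=
  forall x y, p x -> p y ->
    br (e x) (e y) = match t x y, t y x with
                     | Some v, _ => v
                     | None, Some w => - w
                     | None, None => 0
                     end.

(* epsilon_{am} X_m *)
Let rot1 (X : 'I_2 -> gen) (a : 'I_2) : W := \sum_m eps a m *: e (X m).

(* epsilon_{m(a} X_{b)m} *)
Let rot2 (X : 'I_2 -> 'I_2 -> gen) (a b : 'I_2) : W :=
  \sum_m sym (fun a b => eps m a *: e (X b m)) a b.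

(* epsilon_{a(b} X_{c)} *)
Let eps_sym (X : 'I_2 -> gen) (a b c : 'I_2) : W :=
  sym (fun b c => eps a b *: e (X c)) b c.

(* delta_{a(b} epsilon_{c)m} X_m *)
Let delta_eps_sym (X : 'I_2 -> gen) (a b c : 'I_2) : W :=
  \sum_m sym (fun b c => (delta a b * eps c m) *: e (X m)) b c.

(* epsilon_{am} X_{bm} + epsilon_{ab} X_{mm} *)
Let eps_trace (X : 'I_2 -> 'I_2 -> gen) (a b : 'I_2) : W :=
  \sum_m (eps a m *: e (X b m) + eps a b *: e (X m m)).

(* epsilon_{(a(c} delta_{d)b)} *)
Let eps_delta (a b c d : 'I_2) : R :=
  nsym (fun a c d b => eps a c * delta d b : R) a b c d.

(* delta_{(a(c} epsilon_{d)b)} *)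
Let delta_eps (a b c d : 'I_2) : R :=
  nsym (fun a c d b => delta a c * eps d b : R) a b c d.

Definition ebarg_table (x y : gen) : option W :=
  match x, y with
  | J, G1 a => Some (rot1 G1 a)
  | J, P1 a => Some (rot1 P1 a)
  | G1 a, H => Some (- rot1 P1 a)
  | G1 a, G1 b => Some (eps a b *: e Hs)
  | P1 a, G1 b => Some (eps a b *: e Js)
  | _, _ => None
  end.

Definition ebarg1_table (x y : gen) : option W :=
  match x, y with
  | J, G1 a => Some (rot1 G1 a)
  | J, P1 a => Some (rot1 P1 a)
  | G1 a, H => Some (- rot1 P1 a)
  | G1 a, G1 b => Some (eps a b *: e Hs)
  | P1 a, G1 b => Some (eps a b *: e Js)

  | J, J1 a => Some (rot1 J1 a)
  | J, G2 a b => Some (- rot2 G2 a b)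
  | J, H1 a => Some (rot1 H1 a)
  | J, P2 a b => Some (- rot2 P2 a b)
  | G1 a, J1 b => Some (- eps_trace G2 a b)
  | G1 a, H1 b => Some (- eps_trace P2 a b)
  | H, J1 a => Some (rot1 H1 a)
  | H, G2 a b => Some (- rot2 P2 a b)
  | P1 a, J1 b => Some (- eps_trace P2 a b)

  | J1 a, J1 b => Some (eps a b *: e J)
  | J1 a, G2 b c => Some (delta_eps_sym G1 a b c)
  | J1 a, H1 b => Some (eps a b *: e H)
  | J1 a, P2 b c => Some (delta_eps_sym P1 a b c)
  | G2 a b, H1 c => Some (- delta_eps_sym P1 c a b)

  | G2 a b, G2 c d => Some (eps_delta a b c d *: e Hs)
  | P2 a b, G2 c d => Some (eps_delta a b c d *: e Js)
  | P1 a, G2 b c => Some (eps_sym J1s a b c)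
  | G1 a, G2 b c => Some (eps_sym H1s a b c)
  | G1 a, P2 b c => Some (eps_sym J1s a b c)

  | J, H1s a => Some (rot1 H1s a)
  | J, J1s a => Some (rot1 J1s a)
  | H, H1s a => Some (rot1 J1s a)
  | J1 a, Js => Some (- rot1 J1s a)
  | J1 a, Hs => Some (- rot1 H1s a)
  | J1 a, J1s b => Some (eps a b *: e Js)
  | J1 a, H1s b => Some (eps a b *: e Hs)
  | H1 a, Hs => Some (- rot1 J1s a)
  | H1 a, H1s b => Some (eps a b *: e Js)
  | _, _ => None
  end.

Definition ebarg2_table (x y : gen) : option W :=
  match x, y with
  | J, G1 a => Some (rot1 G1 a)
  | J, P1 a => Some (rot1 P1 a)
  | G1 a, H => Some (- rot1 P1 a)
  | G1 a, G1 b => Some (eps a b *: e Hs)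
  | G1 a, P1 b => Some (eps a b *: e Js)

  | J, J1 a => Some (rot1 J1 a)
  | J, G2 a b => Some (- rot2 G2 a b)
  | J, H1 a => Some (rot1 H1 a)
  | J, P2 a b => Some (- rot2 P2 a b)
  | G1 a, G2 b c => Some (- eps_sym J1 a b c)
  | G1 a, P2 b c => Some (- eps_sym H1 a b c)
  | H, J1 a => Some (rot1 H1 a)
  | H, G2 a b => Some (- rot2 P2 a b)
  | P1 a, G2 b c => Some (- eps_sym H1 a b c)

  | J1 a, G2 b c => Some (delta_eps_sym G1 a b c)
  | J1 a, P2 b c => Some (delta_eps_sym P1 a b c)
  | G2 a b, G2 c d => Some (delta_eps a b c d *: e J)
  | G2 a b, H1 c => Some (- delta_eps_sym P1 c a b)
  | G2 a b, P2 c d => Some (delta_eps a b c d *: e H)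

  | G1 a, J1 b => Some (- \sum_m eps a m *: e (P2s m b))
  | G1 a, H1 b => Some (- \sum_m eps a m *: e (G2s m b))
  | P1 a, J1 b => Some (- \sum_m eps a m *: e (G2s m b))
  | J1 a, J1 b => Some (- (eps a b *: e Hs))
  | J1 a, H1 b => Some (- (eps a b *: e Js))

  | J, P2s a b => Some (- rot2 P2s a b)
  | J, G2s a b => Some (- rot2 G2s a b)
  | H, P2s a b => Some (- rot2 G2s a b)
  | G2 a b, Js => Some (- rot2 G2s a b)
  | G2 a b, Hs => Some (- rot2 P2s a b)
  | G2 a b, G2s c d => Some (eps_delta a b c d *: e Js)
  | G2 a b, P2s c d => Some (eps_delta a b c d *: e Hs)
  | P2 a b, Hs => Some (- rot2 G2s a b)
  | P2 a b, P2s c d => Some (eps_delta a b c d *: e Js)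
  | _, _ => None
  end.

End Brackets.

(* delta_{a(c} delta_{d)b} *)
Definition delta_delta (a b c d : 'I_2) : R :=
  sym (fun c d => delta a c * delta d b : R) c d.

Definition pairing1 (x y : gen) : R :=
  match x, y with
  | P1 a, G1 b | G1 a, P1 b => delta a b
  | P2 a b, G2 c d | G2 c d, P2 a b =>
      delta_delta a b c d - 2%:R / 3%:R * (delta a b * delta c d)
  | H, Hs | Hs, H => 1
  | J, Js | Js, J => 1
  | H1 a, H1s b | H1s a, H1 b => delta a b
  | J1 a, J1s b | J1s a, J1 b => delta a b
  | _, _ => 0
  end.

Definition pairing2 (x y : gen) : R :=
  match x, y with
  | P1 a, G1 b | G1 a, P1 b => delta a b
  | H1 a, J1 b | J1 a, H1 b => - delta a b
  | H, Hs | Hs, H => 1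
  | J, Js | Js, J => 1
  | P2 a b, P2s c d | P2s c d, P2 a b => delta_delta a b c d
  | G2 a b, G2s c d | G2s c d, G2 a b => delta_delta a b c d
  | _, _ => 0
  end.

(* The 8-dimensional Extended Bargmann algebra with its generators. *)
Definition is_extended_bargmann (L : vectType R) (br : L -> L -> L)
    (e : gen -> L) : Prop :=
  [/\ is_lie br, \dim {:L} = 8%N, span_of e gen_ebarg = fullv
    & has_brackets br e gen_ebarg (ebarg_table e)].

Definition extended_bargmann_subalgebra (L : vectType R) (br : L -> L -> L)
    (e : gen -> L) : Prop :=
  let W := span_of e gen_ebarg in
  subalgebra br W /\
  is_extended_bargmann (@sub_br R L br W) (fun x => vsproj W (e x)).

End GeneratorsAndTables.

Arguments dext_val {R V} e {g h} in_g in_h in_s st x.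

(* The relations of [is_hs3] are consistent: with t ^+ 2 = sign c, they are
   realized by the traceless 3 x 3 matrices over R[t], with hP = t * hJ,
   hPP = t * hJJ and hJJ proportional to the traceless part of the
   anticommutators of the hJ; (X, Y) below stands for X + t * Y. *)
Module Hs3Existence.
Section Existence.
Variables (R : realFieldType) (c : cosmology).
Let M := 'M[R]_3.
Let W : vectType R := (M * M)%type.
Let s : R := sign R c.

Let comm n (X Y : 'M[R]_n) : 'M[R]_n := X *m Y - Y *m X.
Let brW (x y : W) : W :=
  (comm x.1 y.1 + s *: comm x.2 y.2, comm x.1 y.2 + comm x.2 y.1).

Lemma comm_lie n : is_lie (@comm n).
Proof.
split=> [x a y z|y a x z|x|x y z]; rewrite /comm ?subrr //.
- by rewrite mulmxDr mulmxDl -scalemxAr -scalemxAl opprD addrACA scalerBr.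
- by rewrite mulmxDr mulmxDl -scalemxAr -scalemxAl opprD addrACA scalerBr.
rewrite !mulmxBr !mulmxBl !mulmxA.
have H (a b d e f g : 'M[R]_n) :
    a - b - (d - e) + (d - f - (g - b)) + (g - e - (a - f)) = 0.
  by apply/matrixP=> i j; rewrite !mxE; ring.
exact: H.
Qed.

Let phi (x : W) : 'M[R]_(3 + 3) := block_mx x.1 (s *: x.2) x.2 x.1.

Lemma phiD x y : phi (x + y) = phi x + phi y.
Proof. by rewrite /phi add_block_mx scalerDr. Qed.
Lemma phiZ a x : phi (a *: x) = a *: phi x.
Proof. by rewrite /phi scale_block_mx !scalerA mulrC. Qed.
Lemma phi0 : phi 0 = 0.
Proof. by rewrite /phi scaler0 block_mx0. Qed.
Lemma phi_inj : injective phi.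
Proof. by move=> [X Y] [X' Y'] /eq_block_mx [/= -> _ -> _]. Qed.
Lemma phi_br x y : phi (brW x y) = comm (phi x) (phi y).
Proof.
rewrite /phi /comm !mulmx_block opp_block_mx add_block_mx /=.
rewrite -!scalemxAl -!scalemxAr.
rewrite /comm.
move: (_ *m y.1) (_ *m y.1) (_ *m y.2) (_ *m y.2) (_ *m x.1) (_ *m x.1)
  (_ *m x.2) (_ *m x.2) => a b d e f g h k.
by congr block_mx; apply/matrixP=> i j; rewrite !mxE; ring.
Qed.

Lemma brW_lie : is_lie brW.
Proof.
have [lr ll aa ja] := comm_lie (3 + 3).
split=> [x a y z|y a x z|x|x y z]; apply: phi_inj.
- by rewrite phiD phiZ !phi_br phiD phiZ lr.
- by rewrite phiD phiZ !phi_br phiD phiZ ll.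
- by rewrite phi_br aa phi0.
by rewrite !phiD !phi_br ja phi0.
Qed.

Let t (x : W) : (R^o * R^o)%type := (\tr x.1, \tr x.2).
Lemma t_lin : linear t.
Proof. by move=> a x y; rewrite /t !mxtraceD !mxtraceZ. Qed.
HB.instance Definition _ := GRing.isLinear.Build R W (R^o * R^o)%type _ t t_lin.
Let U := lker (linfun t).
Lemma inU x : (x \in U) = (\tr x.1 == 0) && (\tr x.2 == 0).
Proof. by rewrite memv_ker lfunE /= xpair_eqE. Qed.
Lemma comm_tr (X Y : M) : \tr (comm X Y) = 0.
Proof. by rewrite /comm raddfB /= mxtrace_mulC subrr. Qed.
Lemma brU x y : brW x y \in U.
Proof.
rewrite inU; apply/andP; split=> /=;
  [rewrite (mxtraceD (comm _ _) (_ *: comm _ _)) mxtraceZ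
  | rewrite (mxtraceD (comm _ _) (comm _ _))]; by rewrite !comm_tr ?mulr0 addr0.
Qed.

Lemma dimU : \dim U = 16%N.
Proof.
have := limg_ker_dim (linfun t) fullv; rewrite capfv.
have -> : (linfun t @: fullv = fullv)%VS.
  apply/eqP; rewrite eqEsubv subvf; apply/subvP=> -[a b] _.
  apply/memv_imgP; exists ((a / 3) *: 1%:M, (b / 3) *: 1%:M); rewrite ?memvf //.
  by rewrite lfunE /= /t /= !mxtraceZ !mxtrace1; congr pair; field.
rewrite !dimvf.
rewrite -[RHS]/((16 + 2)%N); exact: addIn.
Qed.

Let V : vectType R := subvs_of U.
Let br : V -> V -> V := @sub_br R W brW U.

Lemma br_lie : is_lie br.
Proof.
have val_br x y : vsval (br x y) = brW (vsval x) (vsval y).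
  by rewrite vsprojK // brU.
have [lr ll aa ja] := brW_lie.
split=> [x a y z|y a x z|x|x y z]; apply: val_inj => /=;
  rewrite ?(linearP, linearD, val_br) /=.
- exact: lr.
- exact: ll.
- exact: aa.
exact: ja.
Qed.

Let k0 : 'I_3 := @Ordinal 3 0 isT.
Let k1 : 'I_3 := @Ordinal 3 1 isT.
Let k2 : 'I_3 := @Ordinal 3 2 isT.

Lemma ord3_ind (P : 'I_3 -> Prop) : P k0 -> P k1 -> P k2 -> forall A, P A.
Proof.
move=> p0 p1 p2 [[|[|[|//]]] lt].
- by rewrite (_ : Ordinal lt = k0) //; apply: val_inj.
- by rewrite (_ : Ordinal lt = k1) //; apply: val_inj.
by rewrite (_ : Ordinal lt = k2) //; apply: val_inj.
Qed.

Lemma big_ord3 (L : nmodType) (F : 'I_3 -> L) : \sum_i F i = F k0 + F k1 + F k2.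
Proof.
by rewrite !big_ord_recl big_ord0 addr0 addrA; congr (F _ + F _ + F _);
  apply: val_inj.
Qed.

Let E (A B : 'I_3) : M := \matrix_(i, j) ((i == A)%:R * mink B j).
Let mJ (A : 'I_3) : M :=
  match val A with
  | 0 => E k2 k1 - E k1 k2
  | 1 => E k2 k0 - E k0 k2
  | _ => E k0 k1 - E k1 k0
  end.
Let mJJ (A B : 'I_3) : M := E A B + E B A - (2 / 3 * mink A B) *: 1%:M.

Lemma mkC A B : mink A B = mink B A :> R.
Proof. by rewrite /mink eq_sym; case: eqP => // ->. Qed.

Lemma mulE A B C D : E A B *m E C D = mink B C *: E A D.
Proof.
apply/matrixP=> i j; rewrite !mxE (bigD1 C) //= big1 => [|k /negPf kC].
  by rewrite !mxE eqxx mul1r addr0 mulrCA mulrA.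
by rewrite !mxE kC mul0r mulr0.
Qed.

Lemma F_J A B : \sum_M eps3 A B M *: raise mJ M = E A B - E B A.
Proof.
elim/ord3_ind: A; elim/ord3_ind: B;
  rewrite /raise !big_ord3 /mJ /eps3 /mink /= ?scale0r ?scale1r ?scaleN1r.
all: by rewrite ?add0r ?addr0 ?opprK ?opprB ?subrr.
Qed.

Lemma J_E A B C : mJ A *m E B C = \sum_M eps_up R M A B *: E M C.
Proof.
rewrite /mJ; elim/ord3_ind: A; rewrite /= mulmxBl !mulE; elim/ord3_ind: B;
  rewrite /eps_up !big_ord3 /eps3 /mink /=
    ?(mul0r, mulr0, mul1r, mulN1r, scale0r, scale1r, scaleN1r,
      subr0, sub0r, addr0, add0r, opprK, oppr0, mulr1, mulrN1).
all: by [].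
Qed.

Lemma E_J A B C : E B C *m mJ A = - \sum_M eps_up R M A C *: E B M.
Proof.
rewrite /mJ; elim/ord3_ind: A; rewrite /= mulmxBr !mulE; elim/ord3_ind: C;
  rewrite /eps_up !big_ord3 /eps3 /mink /=
    ?(mul0r, mulr0, mul1r, mulN1r, scale0r, scale1r, scaleN1r,
      subr0, sub0r, addr0, add0r, opprK, oppr0, mulr1, mulrN1).
all: by [].
Qed.

Lemma eps_tr A B C :
  \sum_M (eps_up R M A B * mink C M + eps_up R M A C * mink B M) = 0.
Proof.
have low A' B' C' : \sum_M eps_up R M A' B' * mink C' M = eps3 C' A' B'.
  by elim/ord3_ind: C'; rewrite /eps_up !big_ord3 /mink /=
    ?(mul0r, mulr0, mul1r, mulN1r, addr0, add0r, opprK, mulr1, mulrN1).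
rewrite big_split /= !low.
by elim/ord3_ind: A; elim/ord3_ind: B; elim/ord3_ind: C;
  rewrite /eps3 /= ?(addr0, subrr, addNr).
Qed.

Lemma comm_scal (X : M) a : comm X (a *: 1%:M) = 0.
Proof. by rewrite /comm -scalemxAr -scalemxAl mulmx1 mul1mx subrr. Qed.

Lemma commC n (X Y : 'M_n) : comm Y X = - comm X Y.
Proof. by rewrite /comm opprB. Qed.
Lemma commDr n (X Y Z : 'M_n) : comm X (Y + Z) = comm X Y + comm X Z.
Proof. by rewrite /comm mulmxDr mulmxDl opprD addrACA. Qed.
Lemma commDl n (X Y Z : 'M_n) : comm (Y + Z) X = comm Y X + comm Z X.
Proof. by rewrite /comm mulmxDr mulmxDl opprD addrACA. Qed.

Lemma comm_J_E A B C : comm (mJ A) (E B C) =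
  \sum_M (eps_up R M A B *: E M C + eps_up R M A C *: E B M).
Proof. by rewrite /comm J_E E_J opprK big_split. Qed.

Lemma comm_J_J A B : comm (mJ A) (mJ B) = vec_vec mJ A B.
Proof.
rewrite /vec_vec F_J.
have e0 : mJ k0 = E k2 k1 + - E k1 k2 by [].
have e1 : mJ k1 = E k2 k0 + - E k0 k2 by [].
have e2 : mJ k2 = E k0 k1 + - E k1 k0 by [].
elim/ord3_ind: A; elim/ord3_ind: B;
  rewrite ?(e0, e1, e2) ?subrr /comm ?subrr //
    !(mulmxDl, mulmxDr, mulNmx, mulmxN) !mulE /mink /=
    !(scale0r, scale1r, scaleN1r, subr0, sub0r, addr0, add0r, opprK, oppr0).
all: by rewrite addrC.
Qed.

Lemma comm_J_JJ A B C : comm (mJ A) (mJJ B C) = vec_ten mJJ A B C.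
Proof.
rewrite {1}/mJJ -scaleNr !commDr comm_scal addr0 /comm !J_E !E_J !opprK.
rewrite /vec_ten /sym /mJJ.
rewrite -!big_split /=.
have T0 : (2 / 3 * \sum_N (eps_up R N A B * mink C N +
                           eps_up R N A C * mink B N)) *: (1%:M : M) = 0.
  by rewrite eps_tr mulr0 scale0r.
rewrite -[LHS]subr0 -[X in _ - X = _]T0 mulr_sumr scaler_suml -sumrB.
apply: eq_bigr => N _; apply/matrixP=> i j.
move: (E N C) (E B N) (E N B) (E C N) (1%:M : M)
  (eps_up R N A B) (eps_up R N A C) => a b d e f u v.
by rewrite !mxE; ring.
Qed.

Lemma comm_JJ_JJ A B C D : comm (mJJ A B) (mJJ C D) = ten_ten mJ A B C D.
Proof.
rewrite {2}/mJJ -scaleNr commDr comm_scal addr0 commC.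
rewrite {1}/mJJ -scaleNr commDr comm_scal addr0 -commC.
rewrite /comm !mulmxDl !mulmxDr !mulE.
have F a X Y :
    - \sum_N (a * eps3 X Y N) *: raise mJ N = a *: E Y X - a *: E X Y.
  rewrite -[RHS]opprB -scalerBr -F_J scaler_sumr; congr (- _).
  by apply: eq_bigr => N _; rewrite scalerA.
rewrite /ten_ten /nsym.
under eq_bigr do rewrite !scalerDl.
rewrite !big_split /= !opprD !F (mkC D B) (mkC C A) (mkC C B) ?(mkC D A).
apply/matrixP=> i j.
move: (mink _ _) (mink _ _) (mink _ _) (mink _ _) => a b d e.
move: (E A D) (E A C) (E B D) (E B C) (E C B) (E C A) (E D B) (E D A)
  => e1 e2 e3 e4 e5 e6 e7 e8.
by rewrite !mxE; ring.
Qed.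

Let injJ (X : M) : V := vsproj U (X, 0).
Let injP (X : M) : V := vsproj U (0, X).
Lemma injJ_lin : linear injJ.
Proof.
move=> a X Y; rewrite /injJ -linearP; congr vsproj.
by congr pair; rewrite /= scaler0 addr0.
Qed.
Lemma injP_lin : linear injP.
Proof.
move=> a X Y; rewrite /injP -linearP; congr vsproj.
by congr pair; rewrite /= scaler0 addr0.
Qed.
HB.instance Definition _ := GRing.isLinear.Build R M V _ injJ injJ_lin.
HB.instance Definition _ := GRing.isLinear.Build R M V _ injP injP_lin.

Lemma val_injJ X : \tr X = 0 -> vsval (injJ X) = (X, 0).
Proof. by move=> t0; rewrite vsprojK // inU /= t0 linear0 !eqxx. Qed.
Lemma val_injP X : \tr X = 0 -> vsval (injP X) = (0, X).
Proof. by move=> t0; rewrite vsprojK // inU /= t0 linear0 !eqxx. Qed.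

Lemma comm0r (X : M) : comm X 0 = 0.
Proof. by rewrite /comm mulmx0 mul0mx subrr. Qed.
Lemma comm0l (X : M) : comm 0 X = 0.
Proof. by rewrite /comm mulmx0 mul0mx subrr. Qed.

Lemma br_ll X Y :
  \tr X = 0 -> \tr Y = 0 -> br (injJ X) (injJ Y) = injJ (comm X Y).
Proof.
move=> tX tY; rewrite /br /sub_br !val_injJ // /injJ; congr vsproj.
by rewrite /brW /= ?(comm0l, comm0r) ?scaler0 ?addr0 ?add0r.
Qed.
Lemma br_lr X Y :
  \tr X = 0 -> \tr Y = 0 -> br (injJ X) (injP Y) = injP (comm X Y).
Proof.
move=> tX tY; rewrite /br /sub_br val_injJ ?val_injP // /injP; congr vsproj.
by rewrite /brW /= ?(comm0l, comm0r) ?scaler0 ?addr0 ?add0r.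
Qed.
Lemma br_rl X Y :
  \tr X = 0 -> \tr Y = 0 -> br (injP X) (injJ Y) = injP (comm X Y).
Proof.
move=> tX tY; rewrite /br /sub_br val_injJ ?val_injP // /injP; congr vsproj.
by rewrite /brW /= ?(comm0l, comm0r) ?scaler0 ?addr0 ?add0r.
Qed.
Lemma br_rr X Y :
  \tr X = 0 -> \tr Y = 0 -> br (injP X) (injP Y) = s *: injJ (comm X Y).
Proof.
move=> tX tY; rewrite -linearZ /br /sub_br !val_injP // /injJ; congr vsproj.
by rewrite /brW /= ?(comm0l, comm0r) ?scaler0 ?addr0 ?add0r.
Qed.

Lemma trE A B : \tr (E A B) = mink A B.
Proof.
rewrite /mxtrace (bigD1 A) //= big1 => [|k /negPf kA]; rewrite !mxE.
  by rewrite eqxx mul1r addr0 mkC.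
by rewrite kA mul0r.
Qed.
Lemma trJ A : \tr (mJ A) = 0.
Proof. by elim/ord3_ind: A; rewrite /mJ /= raddfB /= !trE mkC subrr. Qed.
Lemma trJJ A B : \tr (mJJ A B) = 0.
Proof.
by rewrite /mJJ raddfB raddfD /= mxtraceZ !trE mxtrace1 (mkC B); field.
Qed.

Lemma lin_raise (f : {linear M -> V}) X A :
  raise (fun B => f (X B)) A = f (raise X A).
Proof.
rewrite /raise linear_sum; apply: eq_bigr => B _.
by rewrite linearZ.
Qed.
Lemma lin_vec_vec (f : {linear M -> V}) X A B :
  vec_vec (fun B => f (X B)) A B = f (vec_vec X A B).
Proof.
rewrite /vec_vec linear_sum; apply: eq_bigr => D _.
by rewrite linearZ lin_raise.
Qed.
Lemma lin_vec_ten (f : {linear M -> V}) X A B C :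
  vec_ten (fun B C => f (X B C)) A B C = f (vec_ten X A B C).
Proof.
rewrite /vec_ten linear_sum; apply: eq_bigr => D _.
by rewrite /sym linearD !linearZ.
Qed.
Lemma lin_ten_ten (f : {linear M -> V}) X A B C D :
  ten_ten (fun B => f (X B)) A B C D = f (ten_ten X A B C D).
Proof.
rewrite /ten_ten linearN; congr (- _); rewrite linear_sum.
by apply: eq_bigr => N _; rewrite linearZ lin_raise.
Qed.

Let e : hatted_generators V := HattedGenerators
  (fun A => injJ (mJ A)) (fun A => injP (mJ A))
  (fun A B => injJ (mJJ A B)) (fun A B => injP (mJJ A B)).

Lemma mJJC A B : mJJ A B = mJJ B A.
Proof. by rewrite /mJJ mkC [E A B + _]addrC. Qed.

Lemma mJJ_tr : \sum_A \sum_B mink A B *: mJJ A B = 0.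
Proof.
rewrite !big_ord3 /mink /= ?(scale0r, scale1r, scaleN1r, addr0, add0r).
rewrite /mJJ /mink /=.
apply/matrixP=> i j; rewrite !mxE /mink.
by elim/ord3_ind: i; elim/ord3_ind: j => /=; field.
Qed.

Lemma decomp (X : M) : \tr X = 0 ->
  X = ((X k2 k1 - X k1 k2) / 2) *: mJ k0 - ((X k2 k0 + X k0 k2) / 2) *: mJ k1
     + ((X k0 k1 + X k1 k0) / 2) *: mJ k2
     + \sum_A \sum_B (X A B * mink B B / 2) *: mJJ A B.
Proof.
rewrite /mxtrace big_ord3 => tr0.
have X00 : X k0 k0 = - X k1 k1 - X k2 k2 by lra.
apply/matrixP=> i j; rewrite !big_ord3 !mxE /mJ /mJJ /mink.
by elim/ord3_ind: i; elim/ord3_ind: j; rewrite /= ?mxE /mink /= ?X00; field.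
Qed.

Lemma hs3_e : is_hs3 c br e.
Proof.
split; rewrite /e /=.
- exact: br_lie.
- by rewrite dimvf; exact: dimU.
- apply/eqP; rewrite eqEsubv subvf; apply/subvP=> v _.
  have [tX tY] : \tr (vsval v).1 = 0 /\ \tr (vsval v).2 = 0.
    by have := subvsP v; rewrite inU => /andP[/eqP ? /eqP ?].
  have -> : v = injJ (vsval v).1 + injP (vsval v).2.
    have vD (a b : V) : vsval (a + b) = vsval a + vsval b by rewrite linearD.
    apply: subvs_inj; rewrite vD val_injJ // val_injP //.
    by case: (vsval v) => X Y; congr pair; rewrite /= ?addr0 ?add0r.
  have sub (f : {linear M -> V}) X : \tr X = 0 ->
      {subset [seq f (mJ A) | A <- enum 'I_3] ++
              [seq f (mJJ A B) | A <- enum 'I_3, B <- enum 'I_3]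
         <= hatted_seq e} -> f X \in <<hatted_seq e>>%VS.
    move=> t0 S.
    have sJ A : f (mJ A) \in <<hatted_seq e>>%VS.
      rewrite memv_span // S // mem_cat; apply/orP; left.
      by apply/mapP; exists A; rewrite ?mem_enum.
    have sJJ A B : f (mJJ A B) \in <<hatted_seq e>>%VS.
      rewrite memv_span // S // mem_cat; apply/orP; right.
      by apply/allpairsP; exists (A, B); rewrite !mem_enum.
    have fZ a Y : f (a *: Y) = a *: f Y by rewrite linearZ.
    have fD Y Z : f (Y + Z) = f Y + f Z by rewrite linearD.
    have fN Y : f (- Y) = - f Y by rewrite linearN.
    rewrite (decomp t0); move: (mJ) (mJJ) sJ sJJ => G GG sG sGG.
    by rewrite !big_ord3 !(fD, fN, fZ) !(memvD, memvN, memvZ).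
  by rewrite rpredD // sub // => x; rewrite /hatted_seq /e /= !mem_cat;
    case/orP=> ->; rewrite ?orbT.
- by move=> A B; rewrite mJJC.
- by move=> A B; rewrite mJJC.
- rewrite -[RHS](linear0 injJ) -mJJ_tr linear_sum; apply: eq_bigr => A _.
  by rewrite linear_sum; apply: eq_bigr => B _; rewrite linearZ.
- rewrite -[RHS](linear0 injP) -mJJ_tr linear_sum; apply: eq_bigr => A _.
  by rewrite linear_sum; apply: eq_bigr => B _; rewrite linearZ.
- by move=> A B; rewrite br_ll ?trJ // lin_vec_vec comm_J_J.
- by move=> A B; rewrite br_lr ?trJ // lin_vec_vec comm_J_J.
- by move=> A B; rewrite br_rr ?trJ // lin_vec_vec comm_J_J.
- by move=> A B C; rewrite br_ll ?trJ ?trJJ // lin_vec_ten comm_J_JJ.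
- by move=> A B C; rewrite br_lr ?trJ ?trJJ // lin_vec_ten comm_J_JJ.
- by move=> A B C; rewrite br_rl ?trJ ?trJJ // lin_vec_ten comm_J_JJ.
- by move=> A B C; rewrite br_rr ?trJ ?trJJ // lin_vec_ten comm_J_JJ.
- by move=> A B C D; rewrite br_ll ?trJJ // lin_ten_ten comm_JJ_JJ.
- by move=> A B C D; rewrite br_lr ?trJJ // lin_ten_ten comm_JJ_JJ.
by move=> A B C D; rewrite br_rr ?trJJ // lin_ten_ten comm_JJ_JJ.
Qed.

End Existence.
End Hs3Existence.

Lemma hs3_exists (R : realFieldType) (c : cosmology) :
  exists (V : vectType R) (br : V -> V -> V) (e : hatted_generators V),
    is_hs3 c br e.
Proof. by do 3 eexists; exact: Hs3Existence.hs3_e. Qed.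

(* Main.v *)
Require Import Defs.
From HB Require Import structures.
From mathcomp Require Import all_boot all_order all_algebra.
From mathcomp Require Import reals ring lra.

Set Implicit Arguments.
Unset Strict Implicit.
Unset Printing Implicit Defensive.

Import GRing.Theory Num.Theory.
Local Open Scope ring_scope.

(** Contraction by a subalgebra and double extension preserve the Lie algebra
    axioms in general, so what remains is a statement about structure constants.
    These are rational in the 16 generators and independent of the sign of the
    cosmological constant after the first contraction; in the contracted algebra
    [g] is the abelian ideal [i] of the second contraction, so its metric is
    trivially ad-invariant. In the double extension every bracket is determined
    by the invariant metric: [<[x, y], z>] is, up to a permutation of the three
    generators, either [<[Y, X], X'>] with [Y] in [h] and [X], [X'] in [g], or
    [Y^*([Y', Y''])] with [Y'], [Y''] in [h]. The tables of brackets thus reduce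
    to finitely many identities between rational numbers. *)

(** * Lie algebras, contractions and double extensions *)

(** Real numbers do not compute, and the brackets to be checked are vectors of an abstract algebra;
    naturality bridges both gaps. A table is polymorphic in the coefficient field and in the module
    carrying its entries, so replacing each generator w by the number <w, z> turns a table of
    vectors into a table of rationals, which [vm_compute] compares with the lowered constants. The
    field morphism [ratr] and nondegeneracy of the metric then lead back to vectors. Nondegeneracy
    is certified by the explicit dual bases [dual1] and [dual2], which also show that the starred
    generators span the dual of h. These generators are defined as the linear forms <., x> that the
    metric prescribes and not as a dual basis, from which they may differ: <G_11, G*_11> = 2. *)

Section LinearPredicates.
Variable R : fieldType.

(** [is_lie] states linearity as a proposition about a raw function, so the rules for bundled linear
    maps are restated for such functions. *)
Lemma linear_predD (U W : lmodType R) (f : U -> W) :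
  linear f -> {morph f : x y / x + y}.
Proof. by move=> lf x y; rewrite -[x]scale1r lf !scale1r. Qed.

Lemma linear_pred0 (U W : lmodType R) (f : U -> W) : linear f -> f 0 = 0.
Proof. by move=> lf; apply: (addrI (f 0)); rewrite -linear_predD // !addr0. Qed.

Lemma linear_predZ (U W : lmodType R) (f : U -> W) a :
  linear f -> {morph f : x / a *: x}.
Proof. by move=> lf x; rewrite -[a *: x]addr0 lf linear_pred0 // addr0. Qed.

Lemma linear_predN (U W : lmodType R) (f : U -> W) :
  linear f -> {morph f : x / - x}.
Proof. by move=> lf x; rewrite -scaleN1r linear_predZ // scaleN1r. Qed.

Lemma linear_pred_sum (U W : lmodType R) (f : U -> W) : linear f ->
  forall (I : Type) (r : seq I) (P : pred I) (F : I -> U),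
  f (\sum_(i <- r | P i) F i) = \sum_(i <- r | P i) f (F i).
Proof.
by move=> lf *; apply: big_morph; [exact: linear_predD | exact: linear_pred0].
Qed.

Lemma linear_predI (U W : lmodType R) (f : U -> W) :
  {morph f : x y / x + y} -> (forall a, {morph f : x / a *: x}) -> linear f.
Proof. by move=> fD fZ a x y; rewrite fD fZ. Qed.

(** [linfun] accepts any function and [dext_br] applies it to a raw one; packing the function with
    its linearity gives access to [lfunE]. *)
Lemma linfunE (U W : vectType R) (f : U -> W) : linear f -> linfun f =1 f.
Proof.
move=> lf x.
pose m := GRing.isLinear.Build R U W _ f lf.
pose F : {linear U -> W} := HB.pack f m.
exact: (lfunE F x).
Qed.

(** The coordinate forms of a basis already separate points. This reduces an identity between
    vectors to one between scalars, where [ring] and [lra] apply. *)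
Lemma dual_separates (U : vectType R) (y : U) :
  (forall phi : 'Hom(U, R^o), phi y = 0) -> y = 0.
Proof.
move=> y0; rewrite (coord_vbasis (memvf y)) big1 // => i _.
pose f : U -> R^o := coord (vbasis fullv) i.
have lf : linear f by move=> a u v; rewrite /f linearP.
by have := y0 (linfun f); rewrite linfunE // /f => ->; rewrite scale0r.
Qed.

End LinearPredicates.

Section LieTheory.
Variables (R : fieldType) (L : lmodType R) (br : L -> L -> L).
Hypothesis lie : is_lie br.

Lemma lie_anti x y : br x y = - br y x.
Proof.
have [lr ll aa _] := lie; apply/eqP; rewrite -addr_eq0; apply/eqP.
have := aa (x + y).
by rewrite (linear_predD (lr _)) !(linear_predD (ll _)) /= !aa add0r addr0 addrC.
Qed.

End LieTheory.

Lemma sub_br_lie (R : fieldType) (V : vectType R) (br : V -> V -> V)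
    (U : {vspace V}) : is_lie br -> subalgebra br U -> is_lie (@sub_br R V br U).
Proof.
case=> lr ll aa ja sU.
have E (x y : subvs_of U) : vsval (sub_br br x y) = br (vsval x) (vsval y).
  by rewrite vsprojK // sU ?subvsP.
split=> [x a y z|x a y z|x|x y z]; apply: subvs_inj.
- by rewrite /= E [vsval (_ + _)]linearP lr -!E -linearP.
- by rewrite /= E [vsval (_ + _)]linearP ll -!E -linearP.
- by rewrite /= E aa.
have vD (a b : subvs_of U) : vsval (a + b) = vsval a + vsval b by exact: linearD.
by rewrite !vD !E ja.
Qed.

(** * Contraction along a subalgebra *)

Section Contraction.
Variables (R : fieldType) (V : vectType R) (br : V -> V -> V).
Variables h i : {vspace V}.
Hypothesis (lie : is_lie br) (hi : contractible br h i).

Let ph := daddv_pi h i.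
Let pi := daddv_pi i h.

Let cap0 : (h :&: i = 0)%VS. Proof. by case: hi => -[]. Qed.
Let cap0' : (i :&: h = 0)%VS. Proof. by rewrite capvC. Qed.
Let phi x : ph x + pi x = x.
Proof. by apply: daddv_pi_add => //; case: hi => -[-> _] _; exact: memvf. Qed.
Let phP x : ph x \in h. Proof. exact: memv_pi. Qed.
Let piP x : pi x \in i. Proof. exact: memv_pi. Qed.
Let ph_h x : x \in h -> ph x = x. Proof. exact: daddv_pi_id. Qed.
Let pi_i x : x \in i -> pi x = x. Proof. exact: daddv_pi_id. Qed.
Let ph_i x : x \in i -> ph x = 0.
Proof. by move=> xi; apply: (addIr (pi x)); rewrite phi add0r pi_i. Qed.
Let pi_h x : x \in h -> pi x = 0.
Proof. by move=> xh; apply: (addrI (ph x)); rewrite phi addr0 ph_h. Qed.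

Let brh x y : x \in h -> y \in h -> br x y \in h.
Proof. by case: hi => _; apply. Qed.

Let br' := contraction br h i.

Let br'E x y : br' x y = br (ph x) (ph y) + pi (br (ph x) (pi y) + br (pi x) (ph y)).
Proof. by rewrite linearD addrA. Qed.

Let ph_br' x y : ph (br' x y) = br (ph x) (ph y).
Proof.
rewrite br'E [LHS]linearD [X in X + _]ph_h ?brh //.
by rewrite [X in _ + X]ph_i ?addr0.
Qed.

Let pi_br' x y : pi (br' x y) = pi (br (ph x) (pi y) + br (pi x) (ph y)).
Proof.
rewrite br'E [LHS]linearD [X in X + _]pi_h ?brh //.
by rewrite [X in _ + X]pi_i ?add0r.
Qed.

(** The part [ph w] that the left side omits is bracketed into [h], which [pi] kills. *)
Let pi_pi x w : pi (br (ph x) (pi w)) = pi (br (ph x) w).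
Proof.
have [lr _ _ _] := lie.
rewrite -[in RHS](phi w) (linear_predD (lr _)) linearD /= -[LHS]add0r; congr (_ + _).
by rewrite pi_h ?brh.
Qed.

(** A double bracket of [br'] keeps only the terms with at most one entry from [i], those with
    exactly one being followed by [pi]. The Jacobi identity of [br] holds separately for each
    placement of that entry. *)
Lemma contraction_lie : is_lie br'.
Proof.
have [lr ll aa ja] := lie.
split=> [x|y|x|x y z].
- apply: linear_predI => [y z|a y].
    rewrite !br'E [ph (y + z)]linearD [pi (y + z)]linearD.
    rewrite !(linear_predD (lr _)) /= [X in pi X]addrACA [pi (_ + _)]linearD.
    exact: addrACA.
  rewrite !br'E [ph (a *: y)]linearZ [pi (a *: y)]linearZ.
  by rewrite !(linear_predZ _ (lr _)) /= -scalerDr [pi (_ *: _)]linearZ scalerDr.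
- apply: linear_predI => [x z|a x].
    rewrite !br'E [ph (x + z)]linearD [pi (x + z)]linearD.
    rewrite !(linear_predD (ll _)) /= [X in pi X]addrACA [pi (_ + _)]linearD.
    exact: addrACA.
  rewrite !br'E [ph (a *: x)]linearZ [pi (a *: x)]linearZ.
  by rewrite !(linear_predZ _ (ll _)) /= -scalerDr [pi (_ *: _)]linearZ scalerDr.
- by rewrite br'E aa add0r [br (pi x) _]lie_anti // subrr linear0.
have E u v w : br' u (br' v w) = br (ph u) (br (ph v) (ph w)) +
    pi (br (ph u) (br (ph v) (pi w)) + br (ph u) (br (pi v) (ph w))
        + br (pi u) (br (ph v) (ph w))).
  rewrite [LHS]br'E ph_br' pi_br'; congr (_ + _).
  by rewrite linearD /= pi_pi (linear_predD (lr _)) -linearD.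
rewrite !E [X in X + _]addrACA [LHS]addrACA ja add0r -!linearD /=.
rewrite -[RHS](linear0 pi); congr (pi _).
(* The three groups are the Jacobi identities in which [z], [y] and [x], respectively, contribute
   their [i]-component. *)
by rewrite [LHS](AC (3*3*3) ((1*5*9)*(2*6*7)*(3*4*8))) /= !ja !addr0.
Qed.

End Contraction.

(** * Double extension of G by an abstract action of H *)

Section DoubleExtension.
Variables (R : realFieldType) (G H : vectType R).
Variables (brg : G -> G -> G) (brh : H -> H -> H) (act : H -> G -> G).
Variable B : G -> G -> R.
Hypotheses (lieg : is_lie brg) (lieh : is_lie brh).
Hypotheses (act_linl : forall x, linear (act ^~ x))
  (act_linr : forall y, linear (act y)).
Hypothesis act_der : forall y x x',
  act y (brg x x') = brg (act y x) x' + brg x (act y x').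
Hypothesis act_br : forall y y' x,
  act (brh y y') x = act y (act y' x) - act y' (act y x).
Hypothesis metB : invariant_metric brg B.
Hypothesis actB : forall y x x', B (act y x) x' + B x (act y x') = 0.

Local Notation D := (G * H * 'Hom(H, R^o))%type.

Definition double_ext_br (u v : D) : D :=
  let: (x, y, phi) := u in
  let: (x', y', phi') := v in
  (brg x x' + act y x' - act y' x, brh y y',
   linfun (fun Y : H => (B (act Y x) x' : R^o) - phi' (brh y Y) + phi (brh y' Y))).

Definition double_ext_form (u v : D) : R :=
  B u.1.1 v.1.1 + v.2 u.1.2 + u.2 v.1.2.

Let symB x x' : B x x' = B x' x. Proof. by case: metB. Qed.
Let BDr x x' x'' : B x (x' + x'') = B x x' + B x x''.
Proof. by case: metB => l _ _ _; rewrite (@linear_predD _ _ R^o). Qed.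
Let BDl x x' x'' : B (x' + x'') x = B x' x + B x'' x.
Proof. by rewrite !(symB _ x) BDr. Qed.
Let BZr a x x' : B x (a *: x') = a * B x x'.
Proof. by case: metB => l _ _ _; rewrite (@linear_predZ _ _ R^o). Qed.
Let BZl a x x' : B (a *: x) x' = a * B x x'.
Proof. by rewrite !(symB _ x') BZr. Qed.
Let BNr x x' : B x (- x') = - B x x'.
Proof. by rewrite -scaleN1r BZr mulN1r. Qed.
Let BNl x x' : B (- x) x' = - B x x'.
Proof. by rewrite !(symB _ x') BNr. Qed.

Let third_linear (x x' : G) (y y' : H) (phi phi' : 'Hom(H, R^o)) :
  linear (fun Y : H => (B (act Y x) x' : R^o) - phi' (brh y Y) + phi (brh y' Y)).
Proof.
move=> a Y Z; have [lr _ _ _] := lieh.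
rewrite act_linl !lr BDl BZl !linearP /= /GRing.scale /=; ring.
Qed.

Lemma double_ext_br3 u v Y : (double_ext_br u v).2 Y =
  B (act Y u.1.1) v.1.1 - v.2 (brh u.1.2 Y) + u.2 (brh v.1.2 Y).
Proof.
case: u v => [[x y] phi] [[x' y'] phi'].
by rewrite linfunE //; exact: third_linear.
Qed.

Lemma double_ext_eq (u v : D) :
  u.1.1 = v.1.1 -> u.1.2 = v.1.2 -> (forall Y, u.2 Y = v.2 Y) -> u = v.
Proof. by case: u v => [[? ?] ?] [[? ?] ?] /= -> -> /lfunP ->. Qed.

Lemma double_ext_br1 u v : (double_ext_br u v).1.1 =
  brg u.1.1 v.1.1 + act u.1.2 v.1.1 - act v.1.2 u.1.1.
Proof. by case: u v => [[? ?] ?] [[? ?] ?]. Qed.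

Lemma double_ext_br2 u v : (double_ext_br u v).1.2 = brh u.1.2 v.1.2.
Proof. by case: u v => [[? ?] ?] [[? ?] ?]. Qed.

Let brE := (double_ext_br1, double_ext_br2, double_ext_br3).

Let alt u : double_ext_br u u = 0.
Proof.
have [_ _ aag _] := lieg; have [_ _ aah _] := lieh.
apply: double_ext_eq; rewrite ?brE /= ?aag ?aah ?add0r ?subrr // => Y.
rewrite brE lfunE /=.
(* Skewness of the action gives 2 B(Y x, x) = 0, and 2 is invertible in an ordered field. *)
by have := actB Y u.1.1 u.1.1; rewrite (symB u.1.1) => b; lra.
Qed.

Let linr u : linear (double_ext_br u).
Proof.
have [lrg _ _ _] := lieg; have [lrh _ _ _] := lieh.
move=> a v w; apply: double_ext_eq; rewrite ?brE /= ?brE.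
- rewrite lrg act_linr act_linl /= opprD !scalerDr scalerN.
  by rewrite [LHS](AC (2*2*2) ((1*3*5)*(2*4*6))).
- by rewrite lrh.
move=> Y; rewrite !lfunE /= lfunE /= !brE /=.
have [_ llh _ _] := lieh.
rewrite llh BDr BZr linearP /= !lfunE /= lfunE /= /GRing.scale /=; ring.
Qed.

Let anti u v : double_ext_br u v = - double_ext_br v u.
Proof.
apply: double_ext_eq; rewrite ?brE /= ?brE.
- by rewrite (lie_anti lieg) opprB opprD addrA addrAC [RHS]addrC addrA addrAC.
- exact: lie_anti.
move=> Y; rewrite lfunE /= !brE.
by have := actB Y u.1.1 v.1.1; rewrite (symB u.1.1) => b; lra.
Qed.

Let jacobi u v w :
  double_ext_br u (double_ext_br v w) + double_ext_br v (double_ext_br w u)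
    + double_ext_br w (double_ext_br u v) = 0.
Proof.
have [lrg llg _ jag] := lieg; have [lrh llh _ jah] := lieh.
apply: double_ext_eq; rewrite /= ?brE.
- apply: dual_separates => q; rewrite !act_br.
  (* [ring] does not know that brackets are antisymmetric, so [brgC] and [actC] put them into one
     fixed orientation; what then remains is the Jacobi identity of G. *)
  have brgC a b c d e f : q (brg a (brg b c + act d e - act f b)) =
      q (brg a (brg b c)) - q (brg (act d e) a) + q (brg (act f b) a).
    rewrite !(linear_predD (lrg _)) (linear_predN (lrg _)).
    rewrite [brg a (act f b)](lie_anti lieg) [brg a (act d e)](lie_anti lieg).
    by rewrite opprK !linearD !linearN.
  have actC a b c d e f : q (act a (brg b c + act d e - act f b)) =
      q (brg (act a b) c) - q (brg (act a c) b) + q (act a (act d e))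
        - q (act a (act f b)).
    rewrite !(linear_predD (act_linr _)) (linear_predN (act_linr _)) act_der.
    by rewrite [brg b _](lie_anti lieg) !linearD !linearN.
  have qD a b : q (a + b) = q a + q b by exact: linearD.
  have qN a : q (- a) = - q a by exact: linearN.
  rewrite !(qD, qN) !brgC !actC.
  have := congr1 q (jag u.1.1 v.1.1 w.1.1); rewrite !linearD linear0 /= => j.
  by rewrite -[RHS]j; ring.
- exact: jah.
move=> Y; rewrite !lfunE /= lfunE /= !brE.
case: u v w => [[x y] p] [[x' y'] p'] [[x'' y''] p''] /=.
(* [P] says that H acts on its dual by a representation; [F] that the 2-forms B(Y x, x') depend
   H-equivariantly on Y; [T] that each of them is a cocycle on G, because Y acts by a skew
   derivation and B is invariant. *)
have P (q : 'Hom(H, R^o)) a b :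
    q (brh (brh a b) Y) = q (brh a (brh b Y)) - q (brh b (brh a Y)).
  have := congr1 q (jah a b Y).
  rewrite (lie_anti lieh Y a) (linear_predN (lrh _)) (lie_anti lieh Y (brh a b)).
  by rewrite !linearD !linearN linear0 /= => e; lra.
have F a b c : B (act (brh c Y) a) b =
    B (act Y b) (act c a) - B (act Y a) (act c b).
  rewrite act_br BDl BNl (symB (act Y b)).
  by have := actB c (act Y a) b; have := actB Y (act c a) b => ? ?; lra.
have T : B (act Y x) (brg x' x'') + B (act Y x') (brg x'' x)
    + B (act Y x'') (brg x x') = 0.
  have [_ _ _ inv] := metB.
  have := actB Y x (brg x' x''); rewrite act_der BDr.
  have := inv x (act Y x') x''; rewrite (lie_anti lieg x'' (act _ _)) BNr.
  have := inv x (act Y x'') x'; rewrite (lie_anti lieg x x') BNr.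
  by rewrite !(symB (act Y _) (brg _ x)) => e1 e2 e3; lra.
by rewrite !P !F !BDr !BNr; lra.
Qed.

Lemma double_ext_lie : is_lie double_ext_br.
Proof.
split=> // v a u w; transitivity (- double_ext_br v (a *: u + w)).
  exact: anti.
by rewrite linr opprD -scalerN -(anti u) -(anti w).
Qed.

(** H and its dual are isotropic, orthogonal to G and paired by evaluation, so test vectors
    supported in a single summand detect each component of a vector. *)
Lemma double_ext_invariant_metric :
  invariant_metric double_ext_br double_ext_form.
Proof.
have [linB _ ndB invB] := metB.
have qP (q : 'Hom(H, R^o)) a x y : q (a *: x + y) = a * q x + q y.
  by rewrite linearP.
have qN (q : 'Hom(H, R^o)) x : q (- x) = - q x by rewrite linearN.
have q0 (q : 'Hom(H, R^o)) : q 0 = 0 by rewrite linear0.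
have B0 x : B x 0 = 0 by rewrite -(scale0r x) BZr mul0r.
split.
- move=> [[x y] p] a [[x' y'] p'] [[x'' y''] p''].
  rewrite /double_ext_form /= BDr BZr qP add_lfunE scale_lfunE /GRing.scale /=.
  ring.
- by move=> u v; rewrite /double_ext_form symB addrAC.
- move=> [[x y] p] u0; apply: double_ext_eq => /=.
  + apply: ndB => x'; have := u0 (x', 0, 0).
    by rewrite /double_ext_form /= zero_lfunE q0 !addr0.
  + apply: dual_separates => q; have := u0 (0, 0, q).
    by rewrite /double_ext_form /= B0 q0 add0r addr0.
  move=> Y; have := u0 (0, Y, 0).
  by rewrite /double_ext_form /= B0 !zero_lfunE !add0r.
move=> u v w; rewrite /double_ext_form !brE !BDl !BDr !BNl !BNr.
rewrite (lie_anti lieh w.1.2 u.1.2) (lie_anti lieh w.1.2 v.1.2).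
rewrite (lie_anti lieh v.1.2 u.1.2) !qN.
have := actB w.1.2 u.1.1 v.1.1; have := invB u.1.1 v.1.1 w.1.1.
by rewrite (symB u.1.1 (act v.1.2 _)) => e1 e2; lra.
Qed.

End DoubleExtension.

(** * The double extension for two subspaces of one Lie algebra *)

Section MedinaRevoy.
Variables (R : realFieldType) (V : vectType R) (br : V -> V -> V).
Variables (g h : {vspace V}) (B : subvs_of g -> subvs_of g -> R).
Hypothesis dea : double_extension_assumptions br h B.

Let lie : is_lie br. Proof. exact: dea_lie dea. Qed.
Let brgg : subalgebra br g. Proof. by case: (dea_semidirect dea). Qed.
Let brhh : subalgebra br h. Proof. by case: (dea_semidirect dea). Qed.
Let brhg y x : y \in h -> x \in g -> br y x \in g.
Proof. by case: (dea_semidirect dea) => _ _ _; apply. Qed.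

Let act (y : subvs_of h) (x : subvs_of g) := vsproj g (br (vsval y) (vsval x)).

Let act_val y x : vsval (act y x) = br (vsval y) (vsval x).
Proof. by rewrite vsprojK // brhg ?subvsP. Qed.
Let brg_val x x' : vsval (@sub_br R V br g x x') = br (vsval x) (vsval x').
Proof. by rewrite vsprojK // brgg ?subvsP. Qed.
Let brh_val y y' : vsval (@sub_br R V br h y y') = br (vsval y) (vsval y').
Proof. by rewrite vsprojK // brhh ?subvsP. Qed.

Lemma dext_brE u v :
  dext_br br B u v = double_ext_br (@sub_br R V br g) (@sub_br R V br h) act B u v.
Proof.
have E a b c : vsproj g (a + b - c) = vsproj g a + vsproj g b - vsproj g c.
  by rewrite !linearD linearN.
by case: u v => [[x y] p] [[x' y'] p']; rewrite /dext_br E; congr (_, _, linfun _).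
Qed.

Let vD (U : {vspace V}) (a b : subvs_of U) : vsval (a + b) = vsval a + vsval b.
Proof. exact: linearD. Qed.
Let vN (U : {vspace V}) (a : subvs_of U) : vsval (- a) = - vsval a.
Proof. exact: linearN. Qed.
Let vZ (U : {vspace V}) k (a : subvs_of U) : vsval (k *: a) = k *: vsval a.
Proof. exact: linearZ. Qed.

Let act_linl x : linear (act ^~ x).
Proof.
have [_ ll _ _] := lie; move=> a y y'; apply: subvs_inj.
by rewrite !(vD, vZ) !act_val vD vZ ll.
Qed.

Let act_linr y : linear (act y).
Proof.
have [lr _ _ _] := lie; move=> a x x'; apply: subvs_inj.
by rewrite !(vD, vZ) !act_val vD vZ lr.
Qed.

Let leibniz u v w : br u (br v w) = br (br u v) w + br v (br u w).
Proof.
have [lr _ _ ja] := lie; have := ja u v w.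
rewrite (lie_anti lie w u) (linear_predN (lr _)) (lie_anti lie w (br u v)).
by move/eqP; rewrite subr_eq0 subr_eq => /eqP.
Qed.

Let act_der y x x' : act y (sub_br br x x') =
  sub_br br (act y x) x' + sub_br br x (act y x').
Proof. by apply: subvs_inj; rewrite vD !(act_val, brg_val) leibniz. Qed.

Let act_br y y' x : act (sub_br br y y') x = act y (act y' x) - act y' (act y x).
Proof.
apply: subvs_inj; rewrite vD vN !(act_val, brh_val).
by rewrite (leibniz (vsval y)) addrK.
Qed.

Lemma dext_br3 u v Y : (dext_br br B u v).2 Y =
  B (vsproj g (br (vsval Y) (vsval u.1.1))) v.1.1
  - v.2 (vsproj h (br (vsval u.1.2) (vsval Y)))
  + u.2 (vsproj h (br (vsval v.1.2) (vsval Y))).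
Proof.
rewrite dext_brE double_ext_br3 //; first exact: sub_br_lie lie brhh.
exact: dea_metric dea.
Qed.

Lemma dext_br_lie : is_lie (@dext_br R V br g h B).
Proof.
have [lr ll aa ja] : is_lie
    (double_ext_br (@sub_br R V br g) (@sub_br R V br h) act B).
  apply: double_ext_lie => //; first exact: sub_br_lie lie brgg.
  - exact: sub_br_lie lie brhh.
  - exact: dea_metric dea.
  exact: dea_action dea.
split=> [u a v w|v a u w|u|u v w]; rewrite !dext_brE;
  [exact: lr|exact: ll|exact: aa|exact: ja].
Qed.

Lemma dext_form_invariant : invariant_metric (@dext_br R V br g h B) (@dext_form R V g h B).
Proof.
have [l s n i] : invariant_metric
    (double_ext_br (@sub_br R V br g) (@sub_br R V br h) act B)
    (@double_ext_form R _ (subvs_of h) B).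
  apply: double_ext_invariant_metric => //; first exact: sub_br_lie lie brhh.
  - exact: dea_metric dea.
  exact: dea_action dea.
by split=> // u v w; rewrite !dext_brE; exact: i.
Qed.

End MedinaRevoy.

(** * Rational structure constants *)

Definition o0 : 'I_2 := @Ordinal 2 0 isT.
Definition o1 : 'I_2 := @Ordinal 2 1 isT.

Lemma ord2_ind (P : 'I_2 -> Prop) : P o0 -> P o1 -> forall a, P a.
Proof.
move=> p0 p1 [[|[|//]] lt].
- by rewrite (_ : Ordinal lt = o0) //; apply: val_inj.
by rewrite (_ : Ordinal lt = o1) //; apply: val_inj.
Qed.

Lemma ord2_allP (P : 'I_2 -> bool) : P o0 && P o1 -> forall a, P a.
Proof. by case/andP=> p0 p1; apply: ord2_ind. Qed.

Lemma big_ord2 (L : nmodType) (F : 'I_2 -> L) : \sum_i F i = F o0 + F o1.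
Proof.
by rewrite !big_ord_recl big_ord0 addr0; congr (F _ + F _); apply: val_inj.
Qed.

Definition all1 (P : 'I_2 -> bool) := P o0 && P o1.
Definition all2 (P : 'I_2 -> 'I_2 -> bool) := all1 (fun a => all1 (P a)).

(** The indices are written out so that [vm_compute] does not have to enumerate an ordinal type. *)
Definition all_gens (P : pred gen) : bool :=
  [&& P J, P H, P Hs, P Js,
      all1 (P \o G1), all1 (P \o P1), all1 (P \o J1), all1 (P \o H1),
      all1 (P \o H1s), all1 (P \o J1s),
      all2 (fun a b => P (G2 a b)), all2 (fun a b => P (P2 a b)),
      all2 (fun a b => P (G2s a b)) & all2 (fun a b => P (P2s a b))].

Lemma all_gensP (P : pred gen) : all_gens P -> forall x, P x.
Proof.
case/and5P=> ? ? ? ? /and5P[p1 p2 p3 p4 /and5P[p5 p6 p7 p8 /andP[p9 p10]]].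
case=> // => [a|a|a|a|a b|a b|a|a|a b|a b].
- exact: (ord2_allP p1).
- exact: (ord2_allP p2).
- exact: (ord2_allP p3).
- exact: (ord2_allP p4).
- exact: (ord2_allP (ord2_allP p7 a)).
- exact: (ord2_allP (ord2_allP p8 a)).
- exact: (ord2_allP p5).
- exact: (ord2_allP p6).
- exact: (ord2_allP (ord2_allP p9 a)).
exact: (ord2_allP (ord2_allP p10 a)).
Qed.

Lemma all_gens2P (P : gen -> pred gen) :
  all_gens (fun x => all_gens (P x)) -> forall x y, P x y.
Proof. by move=> /all_gensP PT x; apply: all_gensP. Qed.

(* Positions in a basis of the 16-dimensional algebra; the sum of the indices
   makes the symmetric components G_12 and G_21 share a position. The starred
   generators get the junk value 16. *)
Definition gen_index (x : gen) : nat :=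
  match x with
  | J => 0 | G1 a => 1 + a | H => 3 | P1 a => 4 + a
  | J1 a => 6 + a | G2 a b => 8 + (a + b) | H1 a => 11 + a
  | P2 a b => 13 + (a + b) | _ => 16
  end.

Definition index_gen (i : nat) : gen :=
  nth Hs [:: J; G1 o0; G1 o1; H; P1 o0; P1 o1;
    J1 o0; J1 o1; G2 o0 o0; G2 o0 o1; G2 o1 o1;
    H1 o0; H1 o1; P2 o0 o0; P2 o0 o1; P2 o1 o1] i.

Definition k0 : 'I_3 := @Ordinal 3 0 isT.
Definition k1 : 'I_3 := @Ordinal 3 1 isT.
Definition k2 : 'I_3 := @Ordinal 3 2 isT.
(* Big operators are locked; [sum3] and [sum16] compute. *)
Definition sum3 (F : 'I_3 -> rat) := F k0 + F k1 + F k2.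
Definition sum16 (F : nat -> rat) := foldr (fun i s => F i + s) 0 (iota 0 16).

(* [vec_coord p i A] and [ten_coord p i A B] are the i-th coordinates of
   \hat J_A, \hat J_AB ([p = false]) and \hat P_A, \hat P_AB ([p = true]). The
   component 00 of a tensor is the sum of the components 11 and 22. *)
Definition vec_coord (p : bool) (i : nat) (A : 'I_3) : rat := (i == p * 3 + A)%N%:R.
Definition ten_coord (p : bool) (i : nat) (A B : 'I_3) : rat :=
  let k := (6 + p * 5)%N in
  if (A + B == 0)%N then ((i == k + 2)%N || (i == k + 4)%N)%:R
  else if (A * B == 0)%N then (i == k + (A + B).-1)%N%:R
  else (i == k + (A + B))%N%:R.

Definition vec_vec_coord (X : 'I_3 -> rat) (A B : 'I_3) : rat :=
  sum3 (fun C => eps3 A B C * sum3 (fun D => mink C D * X D)).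
Definition eps_up_rat (M A B : 'I_3) : rat := sum3 (fun N => mink M N * eps3 N A B).
Definition vec_ten_coord (X : 'I_3 -> 'I_3 -> rat) (A B C : 'I_3) : rat :=
  sum3 (fun M => sym (fun B C => eps_up_rat M A B * X C M) B C).
Definition ten_ten_coord (X : 'I_3 -> rat) (A B C D : 'I_3) : rat :=
  - sum3 (fun M => nsym (fun A C D B => mink A C * eps3 D B M : rat) A B C D
           * sum3 (fun D => mink M D * X D)).

Inductive hat := Vec of bool & 'I_3 | Ten of bool & 'I_3 & 'I_3.

Definition hat_of (x : gen) : option hat :=
  match x with
  | J => Some (Vec false ord0) | G1 a => Some (Vec false (sp a))
  | H => Some (Vec true ord0) | P1 a => Some (Vec true (sp a))
  | J1 a => Some (Ten false ord0 (sp a))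
  | G2 a b => Some (Ten false (sp a) (sp b))
  | H1 a => Some (Ten true ord0 (sp a))
  | P2 a b => Some (Ten true (sp a) (sp b))
  | _ => None
  end.

Definition sign_of_ranks c (p q : bool) : rat := if p && q then sign rat c else 1.

(** Brackets that [is_hs3] gives only in the opposite order, namely P with J of equal rank and a
    tensor with a vector, come from antisymmetry. *)
Definition hat_constants c (x y : hat) (i : nat) : rat :=
  match x, y with
  | Vec p A, Vec q B =>
    if p && ~~ q then - vec_vec_coord (vec_coord true i) B A
    else sign_of_ranks c p q * vec_vec_coord (vec_coord (p (+) q) i) A B
  | Vec p A, Ten q B C => sign_of_ranks c p q * vec_ten_coord (ten_coord (p (+) q) i) A B C
  | Ten q B C, Vec p A => - (sign_of_ranks c p q * vec_ten_coord (ten_coord (p (+) q) i) A B C)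
  | Ten p A B, Ten q C D =>
    if p && ~~ q then - ten_ten_coord (vec_coord true i) C D A B
    else sign_of_ranks c p q * ten_ten_coord (vec_coord (p (+) q) i) A B C D
  end.

Definition hs3_C c (x y : gen) i : rat :=
  match hat_of x, hat_of y with
  | Some u, Some v => hat_constants c u v i
  | _, _ => 0
  end.

(** The last branch is a mixed bracket; the test on [index_gen i] realizes the projection onto the
    complement of [h] coordinate by coordinate. *)
Definition contract_C (h : pred gen) (C : gen -> gen -> nat -> rat) x y i : rat :=
  if h x && h y then C x y i
  else if ~~ (h x || h y) || h (index_gen i) then 0 else C x y i.

Definition gal1_C c := contract_C h_proc3 (contract_C h_proc1 (hs3_C c)).
Definition gal2_C c := contract_C h_proc4 (contract_C h_proc1 (hs3_C c)).

Section LoweredConstants.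
Variables (g h s : pred gen) (pr : gen -> gen -> rat) (C : gen -> gen -> nat -> rat).
(* <[x, y], z> *)
Definition lowered x y z := sum16 (fun i => C x y i * pr (index_gen i) z).
(* <[x, y], z> in the double extension of g by h, with s the generators of h^*. *)
Definition lowered_ext x y z : rat :=
  if [&& g x, g y & h z] then lowered z x y else
  if [&& h x, g y & g z] then lowered x y z else
  if [&& g x, h y & g z] then - lowered y x z else
  if [&& h x, h y & s z] then lowered x y z else
  if [&& h x, s y & h z] then - lowered x z y else
  if [&& s x, h y & h z] then lowered y z x else 0.
End LoweredConstants.

(** The same [match] as in [has_brackets], to which it is convertible; given a name so that
    naturality can be stated for it. *)
Definition table_value (W : zmodType) (t : gen -> gen -> option W) x y : W :=
 match t x y, t y x with
                     | Some v, _ => v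
                     | None, Some w => - w
                     | None, None => 0
                     end.

Lemma big_ord3 (L : nmodType) (F : 'I_3 -> L) : \sum_i F i = F k0 + F k1 + F k2.
Proof.
by rewrite !big_ord_recl big_ord0 addr0 addrA; congr (F _ + F _ + F _);
  apply: val_inj.
Qed.

Lemma sum16E (F : nat -> rat) : sum16 F = \sum_(i < 16) F i.
Proof. by rewrite -(big_mkord xpredT F) unlock. Qed.

Section TensorMorphisms.
Variables (R1 R2 : pzRingType) (f : {rmorphism R1 -> R2}).

Lemma rmorph_eps3 A B C : f (eps3 A B C) = eps3 A B C.
Proof.
case: A B C => [[|[|[|//]]] ?] [[|[|[|//]]] ?] [[|[|[|//]]] ?];
  by rewrite /eps3 /= ?rmorphN ?rmorph1 ?rmorph0.
Qed.

Lemma rmorph_mink A B : f (mink A B) = mink A B.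
Proof.
by rewrite /mink; do 2?case: ifP => _; rewrite ?rmorphN ?rmorph1 ?rmorph0.
Qed.

Lemma rmorph_eps a b : f (eps a b) = eps a b.
Proof. exact: rmorph_eps3. Qed.

Lemma rmorph_delta a b : f (delta a b) = delta a b.
Proof. exact: rmorph_nat. Qed.

End TensorMorphisms.

(** Transports decidable equality to [gen], so that membership in [gens] makes sense. *)
Definition gen_code (x : gen) : nat * (nat * nat) :=
  match x with
  | J => (0, (0, 0)) | H => (1, (0, 0)) | Hs => (2, (0, 0)) | Js => (3, (0, 0))
  | G1 a => (4, (a : nat, 0)) | P1 a => (5, (a : nat, 0))
  | J1 a => (6, (a : nat, 0)) | H1 a => (7, (a : nat, 0))
  | J1s a => (8, (a : nat, 0)) | H1s a => (9, (a : nat, 0))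
  | G2 a b => (10, (a : nat, b : nat)) | P2 a b => (11, (a : nat, b : nat))
  | G2s a b => (12, (a : nat, b : nat)) | P2s a b => (13, (a : nat, b : nat))
  end%N.

Lemma gen_code_inj : injective gen_code.
Proof.
case=> [||a|a|a|a|a b|a b|||a|a|a b|a b]; case=> [||c|c|c|c|c d|c d|||c|c|c d|c d] //= [].
all: try by move=> /val_inj ->.
all: by move=> /val_inj -> /val_inj ->.
Qed.

HB.instance Definition _ := Equality.copy gen (inj_type gen_code_inj).

Lemma enum_ord2 : enum 'I_2 = [:: o0; o1].
Proof. by apply: (inj_map val_inj); rewrite val_enum_ord. Qed.

Lemma mem_gens x : x \in gens.
Proof. by move: x; apply: all_gensP; rewrite /gens enum_ord2. Qed.

(** * Coordinates *)

Section SpanOf.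
Variables (R : fieldType) (V : vectType R) (e : gen -> V).

Lemma mem_span_of (p : pred gen) x : p x -> e x \in span_of e p.
Proof. by move=> px; apply/memv_span/map_f; rewrite mem_filter px mem_gens. Qed.

Lemma span_of_subv (p : pred gen) (U : {vspace V}) :
  (forall x, p x -> e x \in U) -> (span_of e p <= U)%VS.
Proof.
by move=> eU; apply/span_subvP=> _ /mapP[x + ->]; rewrite mem_filter => /andP[/eU].
Qed.

(** With the zero subspace for [U] this is an induction principle for multilinear identities: each
    argument is reduced to generators in turn. *)
Lemma linear_span_of (W : vectType R) (f : V -> W) (p : pred gen)
    (U : {vspace W}) : linear f ->
  (forall x, p x -> f (e x) \in U) -> {in span_of e p, forall v, f v \in U}.
Proof.
move=> lf fU v; rewrite -(linfunE lf) memv_preim.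
apply: (subvP (span_of_subv _)) => x /fU.
by rewrite -memv_preim linfunE.
Qed.

Lemma bracket_span_of (br : V -> V -> V) (p q : pred gen) (U : {vspace V}) :
  is_lie br -> (forall x y, p x -> q y -> br (e x) (e y) \in U) ->
  {in span_of e p & span_of e q, forall u v, br u v \in U}.
Proof.
case=> lr ll _ _ brU u v pu qv; apply: (linear_span_of (ll v)) pu => x px.
by apply: (linear_span_of (lr (e x))) qv => y; apply: brU.
Qed.

End SpanOf.

Definition unstarred x := (gen_index x < 16)%N.

(* [p] selects basis generators, and does so independently of the order of the
   indices of a symmetric generator. *)
Definition basic (p : pred gen) := forall x, p x -> unstarred x && p (index_gen (gen_index x)).

Section Coordinates.
Variables (R : realFieldType) (V : vectType R) (e : gen -> V).
Let X := [tuple e (index_gen i) | i < 16].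
Hypothesis basisX : basis_of fullv X.
Hypothesis eG2 : forall a b, e (G2 a b) = e (G2 b a).
Hypothesis eP2 : forall a b, e (P2 a b) = e (P2 b a).

Lemma gen_indexK x : unstarred x -> e x = e (index_gen (gen_index x)).
Proof.
case: x => // [a|a|a|a|a b|a b] _; do ?[elim/ord2_ind: a]; do ?[elim/ord2_ind: b];
  by rewrite // ?(eG2 o1 o0) ?(eP2 o1 o0).
Qed.

Definition gcoord (i : 'I_16) : V -> R := coord X i.

Lemma gcoord_linear i : linear (gcoord i : V -> R^o).
Proof. by move=> a u v; rewrite /gcoord linearP. Qed.

Lemma gcoordD i u v : gcoord i (u + v) = gcoord i u + gcoord i v.
Proof. exact: linearD. Qed.
Lemma gcoordN i u : gcoord i (- u) = - gcoord i u.
Proof. exact: linearN. Qed.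
Lemma gcoordZ i a u : gcoord i (a *: u) = a * gcoord i u.
Proof. exact: linearZ. Qed.
Lemma gcoord0 i : gcoord i 0 = 0.
Proof. exact: linear0. Qed.
Lemma gcoord_sum i (I : Type) (r : seq I) (F : I -> V) :
  gcoord i (\sum_(j <- r) F j) = \sum_(j <- r) gcoord i (F j).
Proof. exact: linear_sum. Qed.

Lemma gcoord_expand v : v = \sum_i gcoord i v *: e (index_gen i).
Proof.
rewrite {1}(coord_basis basisX (memvf v)); apply: eq_bigr => i _.
by rewrite -tnth_nth tnth_mktuple.
Qed.

Lemma gcoord_eq u v : (forall i, gcoord i u = gcoord i v) -> u = v.
Proof.
by move=> uv; rewrite (gcoord_expand u) (gcoord_expand v); apply: eq_bigr => i _; rewrite uv.
Qed.

Lemma gcoord_gen i x : unstarred x -> gcoord i (e x) = (gen_index x == i)%:R.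
Proof.
move=> px; rewrite gen_indexK // -(tnth_mktuple (fun i : 'I_16 => e (index_gen i)) (Ordinal px)).
by rewrite (tnth_nth 0) /gcoord coord_free ?(basis_free basisX).
Qed.

Lemma gcoord_span_of (p : pred gen) v (i : 'I_16) :
  basic p -> v \in span_of e p -> ~~ p (index_gen i) -> gcoord i v = 0.
Proof.
move=> bp vp npi; suff: v \in lker (linfun (gcoord i : V -> R^o)).
  by rewrite memv_ker linfunE => [/eqP|]; [|exact: gcoord_linear].
apply: subvP vp; apply: span_of_subv => x /bp /andP[px pbx].
rewrite memv_ker linfunE; last exact: gcoord_linear.
rewrite gcoord_gen //; case xi: (gen_index x == i); rewrite ?eqxx //.
by rewrite (eqP xi) (negPf npi) in pbx.
Qed.

Lemma mem_span_of_gcoord (p : pred gen) v :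
  (forall i : 'I_16, ~~ p (index_gen i) -> gcoord i v = 0) -> v \in span_of e p.
Proof.
move=> v0; rewrite (gcoord_expand v); apply: memv_suml => i _.
by case pi: (p (index_gen i)); [rewrite memvZ // mem_span_of | rewrite v0 ?pi // scale0r mem0v].
Qed.

Lemma span_of_direct (p q : pred gen) : basic p -> basic q ->
  (forall i : 'I_16, q (index_gen i) = ~~ p (index_gen i)) ->
  direct_decomposition (span_of e p) (span_of e q).
Proof.
move=> bp bq pq; split; apply/eqP.
  rewrite eqEsubv subvf; apply/subvP=> v _; rewrite (gcoord_expand v).
  apply: memv_suml => i _; rewrite memvZ //.
  case pi: (p (index_gen i)); first by apply: (subvP (addvSl _ _)); exact: mem_span_of.
  by apply: (subvP (addvSr _ _)); apply: mem_span_of; rewrite pq pi.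
rewrite -subv0; apply/subvP=> v; rewrite memv_cap memv0 => /andP[vp vq].
apply/eqP/gcoord_eq => i; rewrite gcoord0; case pi: (p (index_gen i)).
  by rewrite (gcoord_span_of bq vq) ?pq ?pi.
by rewrite (gcoord_span_of bp vp) ?pi.
Qed.

Section Contracted.
Variables (br : V -> V -> V) (C : gen -> gen -> nat -> rat).
Hypothesis lie : is_lie br.

Definition structure_constants := forall x y (i : 'I_16), unstarred x -> unstarred y ->
  gcoord i (br (e x) (e y)) = ratr (C x y i).

Hypothesis brC : structure_constants.
Variables p q : pred gen.
Hypotheses (bp : basic p) (bq : basic q).
Hypothesis pq : forall x, unstarred x -> q x = ~~ p x.

Let pqi (i : 'I_16) : q (index_gen i) = ~~ p (index_gen i).
Proof. by apply: pq; case: i; do 16?[case=> //]. Qed.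

Lemma span_of_contractible :
  (forall x y (i : 'I_16), p x -> p y -> ~~ p (index_gen i) -> C x y i = 0) ->
  contractible br (span_of e p) (span_of e q).
Proof.
move=> hs3_C; split; first exact: span_of_direct.
apply: bracket_span_of => // x y px py; apply: mem_span_of_gcoord => i npi.
case/andP: (bp px) => ? _; case/andP: (bp py) => ? _.
by rewrite brC // hs3_C // rmorph0.
Qed.

End Contracted.

Section Projection.
Variables p q : pred gen.
Hypotheses (bp : basic p) (bq : basic q).
Hypothesis pq : forall x, unstarred x -> q x = ~~ p x.

Let pqi (i : 'I_16) : q (index_gen i) = ~~ p (index_gen i).
Proof. by apply: pq; case: i; do 16?[case=> //]. Qed.
Let cap0 : (span_of e p :&: span_of e q = 0)%VS.
Proof. by case: (span_of_direct bp bq pqi). Qed.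
Let full : (span_of e p + span_of e q = fullv)%VS.
Proof. by case: (span_of_direct bp bq pqi). Qed.

Lemma gcoord_pi v (i : 'I_16) : gcoord i (daddv_pi (span_of e p) (span_of e q) v) =
  if p (index_gen i) then gcoord i v else 0.
Proof.
case pi: (p (index_gen i)); last by rewrite (gcoord_span_of bp (memv_pi _ _ _)) ?pi.
rewrite -[in RHS](daddv_pi_add cap0 (_ : v \in _)) ?full ?memvf //.
by rewrite gcoordD [X in _ + X](gcoord_span_of bq (memv_pi _ _ _)) ?pqi ?pi // addr0.
Qed.

Lemma pi_gen x : unstarred x -> daddv_pi (span_of e p) (span_of e q) (e x) =
  if p x then e x else 0.
Proof.
move=> px; case pi: (p x); first by rewrite daddv_pi_id // mem_span_of.
apply: gcoord_eq => i; rewrite gcoord_pi gcoord0 (gcoord_gen _ px); case: ifP => // pb.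
(* A generator outside [p] lies in [q], hence so does its position in the basis, which therefore
   cannot be a position in [p]. *)
case: eqP => // xi; have qx : q x by rewrite pq ?pi.
by case/andP: (bq qx) => _; rewrite xi pqi pb.
Qed.

End Projection.

Lemma contraction_constants (br : V -> V -> V) C p q :
  is_lie br -> structure_constants br C -> basic p -> basic q ->
  (forall x, unstarred x -> q x = ~~ p x) ->
  structure_constants (contraction br (span_of e p) (span_of e q)) (contract_C p C).
Proof.
move=> [lr ll _ _] brC bp bq pq x y i px py.
have qp z : unstarred z -> p z = ~~ q z by move=> pz; rewrite pq // negbK.
have pb : q (index_gen i) = ~~ p (index_gen i) by apply: pq; case: (i); do 16?[case=> //].
rewrite /contraction !(pi_gen bp bq pq) // !(pi_gen bq bp qp) // !pq // /contract_C.
have b0 u : br u 0 = 0 by exact: linear_pred0 (lr u).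
have b0' u : br 0 u = 0 by exact: linear_pred0 (ll u).
case: (p x); case: (p y); rewrite /= ?(b0, b0', linear0, addr0, add0r).
- exact: brC.
- rewrite (gcoord_pi bq bp qp) pb brC //.
  by case: (p (index_gen i)); rewrite ?rmorph0.
- rewrite (gcoord_pi bq bp qp) pb brC //.
  by case: (p (index_gen i)); rewrite ?rmorph0.
by rewrite gcoord0 rmorph0.
Qed.

End Coordinates.

(** * Basis and structure constants of the original algebra *)

Section Hs3Coordinates.
Variables (R : realFieldType) (c : cosmology) (V : vectType R).
Variables (br : V -> V -> V) (hv : hatted_generators V).
Hypothesis hs3 : is_hs3 c br hv.
Let e := gen_val hv.
Let X := [tuple e (index_gen i) | i < 16].

Lemma gen_val_G2C a b : e (G2 a b) = e (G2 b a).
Proof. exact: hs3_JJC hs3 _ _. Qed.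
Lemma gen_val_P2C a b : e (P2 a b) = e (P2 b a).
Proof. exact: hs3_PPC hs3 _ _. Qed.

Lemma ord3_split (P : 'I_3 -> Prop) : P ord0 -> (forall a, P (sp a)) -> forall A, P A.
Proof. by move=> p0 ps A; case: (unliftP ord0 A) => [a ->|->]. Qed.

Let vec (p : bool) A := if p then hP hv A else hJ hv A.
Let ten (p : bool) A B := if p then hPP hv A B else hJJ hv A B.

Let tenC p A B : ten p A B = ten p B A.
Proof. by rewrite /ten; case: p; [apply: hs3_PPC hs3 _ _ | apply: hs3_JJC hs3 _ _]. Qed.

Let trace p : ten p ord0 ord0 = ten p (sp o0) (sp o0) + ten p (sp o1) (sp o1).
Proof.
have : \sum_A \sum_B mink A B *: ten p A B = 0.
  by case: p; [exact: hs3_trPP hs3 | exact: hs3_trJJ hs3].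
rewrite !big_ord3 /mink /= !scale0r !scale1r scaleN1r !addr0 !add0r.
move/eqP; rewrite -addrA addrC subr_eq0 => /eqP /esym.
have -> : k0 = ord0 by apply: val_inj.
have -> : k1 = sp o0 by apply: val_inj.
by have -> : k2 = sp o1 by apply: val_inj.
Qed.

Let e_vec p A : exists2 x, vec p A = e x & unstarred x /\
  forall i, (gen_index x == i)%:R = vec_coord p i A.
Proof.
elim/ord3_split: A => [|a]; case: p.
- by exists H => //; split=> // i; rewrite eq_sym.
- by exists J => //; split=> // i; rewrite eq_sym.
- exists (P1 a) => //; split=> [|i]; first by move: a; apply: ord2_allP.
  by rewrite eq_sym /vec_coord /= /bump leq0n mul1n addnA.
exists (G1 a) => //; split=> [|i]; first by move: a; apply: ord2_allP.
by rewrite eq_sym.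
Qed.

(** Sixteen vectors in dimension 16 need only span, and they yield all the hatted generators once
    the 00 components are eliminated by tracelessness. *)
Lemma basis_gen_val : basis_of fullv X.
Proof.
have eX x : unstarred x -> e x \in <<X>>%VS.
  move=> px; rewrite (gen_indexK gen_val_G2C gen_val_P2C px).
  have -> : e (index_gen (gen_index x)) = tnth X (Ordinal px) by rewrite tnth_mktuple.
  exact/memv_span/mem_tnth.
have vX p A : vec p A \in <<X>>%VS by case: (e_vec p A) => x -> [/eX].
have sX p a b : ten p (sp a) (sp b) \in <<X>>%VS.
  case: p; [apply: (eX (P2 a b)) | apply: (eX (G2 a b))];
  by move: a b; apply: ord2_ind; apply: ord2_allP.
have zX p a : ten p ord0 (sp a) \in <<X>>%VS.
  case: p; [apply: (eX (H1 a)) | apply: (eX (J1 a))]; by move: a; apply: ord2_allP.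
have tX p A B : ten p A B \in <<X>>%VS.
  elim/ord3_split: A => [|a]; elim/ord3_split: B => [|b] //.
    by rewrite trace rpredD.
  by rewrite tenC.
rewrite basisEdim size_tuple (hs3_dim hs3) leqnn andbT -(hs3_span hs3).
apply/span_subvP=> v; rewrite !mem_cat => /or4P[] => [/mapP|/mapP|/allpairsP|/allpairsP].
- by case=> A _ ->; exact: (vX false).
- by case=> A _ ->; exact: (vX true).
- by case=> -[A B] [_ _ ->]; exact: (tX false).
by case=> -[A B] [_ _ ->]; exact: (tX true).
Qed.

Local Notation gcoord := (@gcoord R V e).

Let gcoord_vec p A i : gcoord i (vec p A) = ratr (vec_coord p i A).
Proof.
case: (e_vec p A) => x -> [px <-]; rewrite ratr_nat.
exact: (gcoord_gen basis_gen_val gen_val_G2C gen_val_P2C).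
Qed.

Let gcoord_ten p A B i : gcoord i (ten p A B) = ratr (ten_coord p i A B).
Proof.
have cr x : unstarred x -> gcoord i (e x) = (gen_index x == i)%:R.
  exact: (gcoord_gen basis_gen_val gen_val_G2C gen_val_P2C).
have s00 a b : gcoord i (ten p (sp a) (sp b)) = ratr (ten_coord p i (sp a) (sp b)).
  rewrite -[ten p _ _]/(if p then e (P2 a b) else e (G2 a b)).
  rewrite (fun_if (gcoord _)) !cr; last 2 first.
  - by move: a b; apply: ord2_ind; apply: ord2_allP.
  - by move: a b; apply: ord2_ind; apply: ord2_allP.
  elim/ord2_ind: a; elim/ord2_ind: b; case: p; rewrite /ten_coord ratr_nat /=
    ?(eq_sym (i : nat)) //.
have s0 a : gcoord i (ten p ord0 (sp a)) = ratr (ten_coord p i ord0 (sp a)).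
  rewrite -[ten p _ _]/(if p then e (H1 a) else e (J1 a)).
  rewrite (fun_if (gcoord _)) !cr; last 2 first.
  - by move: a; apply: ord2_allP.
  - by move: a; apply: ord2_allP.
  clear s00; elim/ord2_ind: a; case: p; rewrite /ten_coord ratr_nat /= ?(eq_sym (i : nat)) //.
have ctC A' B' : ten_coord p i A' B' = ten_coord p i B' A'.
  by rewrite /ten_coord (addnC A') (mulnC A').
elim/ord3_split: A => [|a]; elim/ord3_split: B => [|b] //; last by rewrite tenC ctC.
rewrite trace gcoordD !s00 -rmorphD; congr ratr.
clear cr s00 s0 ctC; rewrite /ten_coord /=; case: p; case: i; do 16?[case=> //].
Qed.

Let gcoord_raise i p A :
  gcoord i (raise (vec p) A) = ratr (sum3 (fun D => mink A D * vec_coord p i D)).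
Proof.
rewrite /raise gcoord_sum big_ord3 /sum3 !rmorphD /= !rmorphM /= !rmorph_mink.
by rewrite !gcoordZ !gcoord_vec.
Qed.

Let gcoord_vec_vec i p A B :
  gcoord i (vec_vec (vec p) A B) = ratr (vec_vec_coord (vec_coord p i) A B).
Proof.
rewrite /vec_vec gcoord_sum big_ord3 /vec_vec_coord /sum3 !rmorphD /= !rmorphM /= !rmorph_eps3.
by rewrite !gcoordZ !gcoord_raise.
Qed.

Let eps_upE M A B : ratr (eps_up_rat M A B) = eps_up R M A B.
Proof.
by rewrite /eps_up /eps_up_rat /sum3 big_ord3 !rmorphD /= !rmorphM /= !rmorph_mink !rmorph_eps3.
Qed.

Let gcoord_vec_ten i p A B C :
  gcoord i (vec_ten (ten p) A B C) = ratr (vec_ten_coord (ten_coord p i) A B C).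
Proof.
rewrite /vec_ten gcoord_sum big_ord3 /vec_ten_coord /sum3 /sym !rmorphD /= !rmorphM /= !eps_upE.
by rewrite !gcoordD !gcoordZ !gcoord_ten.
Qed.

Let gcoord_ten_ten i p A B C D :
  gcoord i (ten_ten (vec p) A B C D) = ratr (ten_ten_coord (vec_coord p i) A B C D).
Proof.
rewrite /ten_ten /nsym gcoordN gcoord_sum big_ord3 /ten_ten_coord rmorphN; congr (- _).
rewrite [in RHS]/sum3 !gcoordZ !gcoord_raise /sum3 /nsym !(rmorphD, rmorphM) /=.
by rewrite !rmorph_mink !rmorph_eps3.
Qed.

Definition val_of_hat (u : hat) : V :=
  match u with Vec p A => vec p A | Ten p A B => ten p A B end.

Lemma gcoord_bracket_hat u v i :
  gcoord i (br (val_of_hat u) (val_of_hat v)) = ratr (hat_constants c u v i).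
Proof.
have lie := hs3_lie hs3.
have sc : ratr (sign rat c) = sign R c by case: (c); rewrite /= ?rmorphN rmorph1.
case: u v => [p A|p A B] [q A'|q A' B'];
  rewrite /val_of_hat /vec /ten /hat_constants /sign_of_ranks.
- case: p; case: q => /=; rewrite ?mul1r ?rmorphM ?rmorphN /= ?sc.
  + by rewrite (hs3_P_P hs3) gcoordZ; congr (_ * _); apply: (gcoord_vec_vec i false).
  + by rewrite (lie_anti lie) (hs3_J_P hs3) gcoordN; congr (- _); apply: (gcoord_vec_vec i true).
  + by rewrite (hs3_J_P hs3); apply: (gcoord_vec_vec i true).
  by rewrite (hs3_J_J hs3); apply: (gcoord_vec_vec i false).
- case: p; case: q => /=; rewrite ?mul1r ?rmorphM ?rmorphN /= ?sc.
  + by rewrite (hs3_P_PP hs3) gcoordZ; congr (_ * _); apply: (gcoord_vec_ten i false).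
  + by rewrite (hs3_P_JJ hs3); apply: (gcoord_vec_ten i true).
  + by rewrite (hs3_J_PP hs3); apply: (gcoord_vec_ten i true).
  by rewrite (hs3_J_JJ hs3); apply: (gcoord_vec_ten i false).
- rewrite (lie_anti lie) gcoordN rmorphN; congr (- _).
  case: p; case: q => /=; rewrite ?mul1r ?rmorphM ?rmorphN /= ?sc.
  + by rewrite (hs3_P_PP hs3) gcoordZ; congr (_ * _); apply: (gcoord_vec_ten i false).
  + by rewrite (hs3_J_PP hs3); apply: (gcoord_vec_ten i true).
  + by rewrite (hs3_P_JJ hs3); apply: (gcoord_vec_ten i true).
  by rewrite (hs3_J_JJ hs3); apply: (gcoord_vec_ten i false).
case: p; case: q => /=; rewrite ?mul1r.
+ rewrite (hs3_PP_PP hs3) gcoordZ rmorphM /= sc.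
  by congr (_ * _); apply: (gcoord_ten_ten i false).
+ rewrite (lie_anti lie) (hs3_JJ_PP hs3) gcoordN [in RHS]rmorphN.
  by congr (- _); apply: (gcoord_ten_ten i true).
+ by rewrite (hs3_JJ_PP hs3); apply: (gcoord_ten_ten i true).
by rewrite (hs3_JJ_JJ hs3); apply: (gcoord_ten_ten i false).
Qed.

Lemma hs3_constants : structure_constants e br (hs3_C c).
Proof.
have eh x : unstarred x -> exists2 u, hat_of x = Some u & e x = val_of_hat u.
  by case: x => // *; eexists.
move=> x y i /eh[u xu ->] /eh[v yv ->].
by rewrite /hs3_C xu yv gcoord_bracket_hat.
Qed.

End Hs3Coordinates.

(* Naturality serves twice: to pair the entries of a table with a generator, and
   to pass from rational to real coefficients. *)
Definition natural_table
    (t : forall (F : fieldType) (W : lmodType F),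
       (gen -> W) -> gen -> gen -> option W) :=
  forall (F1 F2 : fieldType) (sigma : {rmorphism F1 -> F2})
    (W1 : lmodType F1) (W2 : lmodType F2) (f : W1 -> W2),
  {morph f : u v / u + v} -> {morph f : u / - u} ->
  (forall a u, f (a *: u) = sigma a *: f u) ->
  forall (e1 : gen -> W1) (e2 : gen -> W2), (forall x, e2 x = f (e1 x)) ->
  forall x y, t F2 W2 e2 x y = omap f (t F1 W1 e1 x y).

(** Entries are sums of generators with coefficients built from epsilon and delta, whose values 0,
    1, -1 every ring morphism fixes. *)
Lemma tables_natural : [/\ natural_table (@ebarg_table),
  natural_table (@ebarg1_table) & natural_table (@ebarg2_table)].
Proof.
split; move=> F1 F2 sigma W1 W2 f fD fN fZ e1 e2 ef
    [||?|?|?|?|? ?|? ?|||?|?|? ?|? ?] [||?|?|?|?|? ?|? ?|||?|?|? ?|? ?] //=;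
  by rewrite ?big_ord2 /nsym /sym /= !(fN, fD, fZ, rmorphD, rmorphM, rmorph_eps,
    rmorph_delta, ef).
Qed.

Lemma table_value_natural
    (t : forall (F : fieldType) (W : lmodType F),
       (gen -> W) -> gen -> gen -> option W)
    (F1 F2 : fieldType) (sigma : {rmorphism F1 -> F2})
    (W1 : lmodType F1) (W2 : lmodType F2) (f : W1 -> W2) e1 e2 x y :
  natural_table t ->
  {morph f : u v / u + v} -> (forall a u, f (a *: u) = sigma a *: f u) ->
  (forall x, e2 x = f (e1 x)) ->
  table_value (@t F2 W2 e2) x y = f (table_value (@t F1 W1 e1) x y).
Proof.
move=> nat fD fZ ef.
have f0 : f 0 = 0 by rewrite -(scale0r 0) fZ rmorph0 scale0r.
have fN : {morph f : u / - u} by move=> u; rewrite -scaleN1r fZ rmorphN1 scaleN1r.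
rewrite /table_value !(nat _ _ sigma _ _ f fD fN fZ e1 e2 ef).
by case: (t _ _ _ x y) => [v|] //=; case: (t _ _ _ y x) => [v|] //=.
Qed.

Definition ebarg_gens :=
  [:: J; H; G1 o0; G1 o1; P1 o0; P1 o1; Hs; Js].
(** Under both pairings the Gram matrix of [ebarg_gens] against this list is the identity, which
    makes the eight generators independent. *)
Definition ebarg_duals :=
  [:: Js; Hs; P1 o0; P1 o1; G1 o0; G1 o1; H; J].

Lemma gen_ebargP x : gen_ebarg x -> exists i : 'I_8, x = nth J ebarg_gens i.
Proof.
case: x => // [||a|a||] _; do ?[elim/ord2_ind: a].
- by exists (@Ordinal 8 0 isT).
- by exists (@Ordinal 8 1 isT).
- by exists (@Ordinal 8 2 isT).
- by exists (@Ordinal 8 3 isT).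
- by exists (@Ordinal 8 4 isT).
- by exists (@Ordinal 8 5 isT).
- by exists (@Ordinal 8 6 isT).
by exists (@Ordinal 8 7 isT).
Qed.

Lemma gen_ebarg_nth (i : 'I_8) : gen_ebarg (nth J ebarg_gens i).
Proof. by case: i; do 8?[case=> //]. Qed.

Lemma ebarg_table_span (F : fieldType) (W : vectType F) (f : gen -> W) x y :
  gen_ebarg x -> gen_ebarg y ->
  table_value (ebarg_table f) x y \in span_of f gen_ebarg.
Proof.
have fin z : gen_ebarg z -> f z \in span_of f gen_ebarg by exact: mem_span_of.
case: x => // [||a|a||] _; case: y => // [||b|b||] _; rewrite /table_value /= ?mem0v //;
  by rewrite ?big_ord2 ?(rpredN, rpredD) ?rpredZ ?fin.
Qed.

(** * Double extensions given by structure constants *)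

Section Extension.
Variables (R : realFieldType) (V : vectType R) (e : gen -> V).
Hypothesis basisX : basis_of fullv [tuple e (index_gen i) | i < 16].
Hypothesis eG2 : forall a b, e (G2 a b) = e (G2 b a).
Hypothesis eP2 : forall a b, e (P2 a b) = e (P2 b a).
Variables (br : V -> V -> V) (C : gen -> gen -> nat -> rat).
Hypotheses (lie : is_lie br) (brC : structure_constants e br C).
Variables (g h s : pred gen).
Variable pr : forall F : fieldType, gen -> gen -> F.
(** [dual i] writes the i-th coordinate form as a combination of pairings with generators: a
    certificate that the pairing is nondegenerate. *)
Variable dual : nat -> seq (rat * gen).
Variable tab : forall (F : fieldType) (W : lmodType F),
  (gen -> W) -> gen -> gen -> option W.

Let in_e x := [|| g x, h x | s x].

Hypotheses (basic_g : basic g) (basic_h : basic h).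
Hypothesis gh : forall x, unstarred x -> h x = ~~ g x.
Hypothesis s_starred : forall x, s x ==> ~~ unstarred x.
Hypothesis pr_rat : forall x y, ratr (pr rat x y) = pr R x y.
Hypothesis prC : forall x y, pr rat x y == pr rat y x.
Hypothesis pr_bas : forall x z, unstarred x ==> (pr rat x z == pr rat (index_gen (gen_index x)) z).
Hypothesis pr_support : forall x z, in_e z && (pr rat x z != 0) ==>
  [|| g x && g z, h x && s z | s x && h z].
Hypothesis dual_support : forall i : 'I_16,
  all (fun cy => if g (index_gen i) then g cy.2 else s cy.2) (dual i).
Hypothesis dual_pairing : forall i j : 'I_16,
  \sum_(cy <- dual i) cy.1 * pr rat (index_gen j) cy.2 == (i == j)%:R.
Hypothesis C_hhg : forall x y (i : 'I_16), h x -> h y -> ~~ h (index_gen i) -> C x y i = 0.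
Hypothesis C_hgh : forall x y (i : 'I_16), h x -> g y -> ~~ g (index_gen i) -> C x y i = 0.
Hypothesis C_gg : forall x y (i : 'I_16), g x -> g y -> C x y i = 0.
Hypothesis K_skew : forall x y z, [&& h x, g y & g z] ==>
  (lowered (pr rat) C x y z + lowered (pr rat) C x z y == 0).
Hypothesis tab_natural : natural_table tab.
Hypothesis tab_lowered : forall x y z, [&& in_e x, in_e y & in_e z] ==>
  (table_value (@tab rat rat^o (fun w => pr rat w z)) x y == lowered_ext g h s (pr rat) C x y z).

Hypothesis tab_ebarg : forall (F : fieldType) (W : lmodType F) (f : gen -> W) x y,
  gen_ebarg x -> gen_ebarg y -> table_value (tab f) x y = table_value (ebarg_table f) x y.
Hypothesis ebarg_in : forall x, gen_ebarg x ==> in_e x.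
Hypothesis ebarg_dual : forall i j : 'I_8,
  pr rat (nth J ebarg_gens i) (nth J ebarg_duals j) == (i == j)%:R.
Hypothesis ebarg_dual_in : all in_e ebarg_duals.

Let G := span_of e g.
Let Hh := span_of e h.
Local Notation gcoord := (@gcoord R V e).

Lemma unstarred_bas (i : 'I_16) : unstarred (index_gen i).
Proof. by case: i; do 16?[case=> //]. Qed.

Let gcoord_e i x : unstarred x -> gcoord i (e x) = (gen_index x == i)%:R.
Proof. exact: (gcoord_gen basisX eG2 eP2). Qed.

Let prRC x y : pr R x y = pr R y x.
Proof. by rewrite -!pr_rat (eqP (prC x y)). Qed.

(* The pairing with the generator y, as a linear form on the unextended algebra. *)
Let P (y : gen) (v : V) : R^o := \sum_i gcoord i v * pr R (index_gen i) y.

Let P_linear y : linear (P y).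
Proof.
move=> a u v; rewrite /P scaler_sumr -big_split; apply: eq_bigr => i _ /=.
by rewrite gcoordD gcoordZ mulrDl -mulrA.
Qed.

Let P_e y x : unstarred x -> P y (e x) = pr R x y.
Proof.
move=> ux; rewrite /P (bigD1 (Ordinal ux)) //= gcoord_e // eqxx mul1r big1 => [|i].
  by rewrite addr0 -!pr_rat -(eqP (implyP (pr_bas x y) ux)).
by rewrite gcoord_e // eq_sym => /negPf; rewrite -val_eqE /= => ->; rewrite mul0r.
Qed.

Let P_br x y z : unstarred x -> unstarred y ->
  P z (br (e x) (e y)) = ratr (lowered (pr rat) C x y z).
Proof.
move=> ux uy; rewrite /lowered sum16E rmorph_sum; apply: eq_bigr => i _.
by rewrite rmorphM /= brC // pr_rat.
Qed.

Let P_dual v (i : 'I_16) : \sum_(cy <- dual i) ratr cy.1 * P cy.2 v = gcoord i v.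
Proof.
under eq_bigr do rewrite /P mulr_sumr; rewrite exchange_big /=.
under eq_bigr => j _.
  under eq_bigr do rewrite -pr_rat mulrCA -rmorphM.
  rewrite -mulr_sumr -rmorph_sum (eqP (dual_pairing i j)) rmorph_nat; over.
rewrite (bigD1 i) //= eqxx mulr1 big1 ?addr0 // => j.
by rewrite eq_sym => /negPf ->; rewrite mulr0.
Qed.

Let P_dual0 v (i : 'I_16) : (forall cy, cy \in dual i -> P cy.2 v = 0) -> gcoord i v = 0.
Proof. by move=> P0; rewrite -P_dual big_seq big1 // => cy /P0 ->; rewrite mulr0. Qed.

(** The bilinear extension of [pr] to all of V. The metric on g is its restriction, and multilinear
    arguments can be carried out on V without [vsproj]. *)
Let Bv (v w : V) : R^o := \sum_i gcoord i w * P (index_gen i) v.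

Let Bv_linear v : linear (Bv v).
Proof.
move=> a u w; rewrite /Bv scaler_sumr -big_split; apply: eq_bigr => i _ /=.
by rewrite gcoordD gcoordZ mulrDl -mulrA.
Qed.

Let BvC v w : Bv v w = Bv w v.
Proof.
rewrite /Bv /P; under eq_bigr do rewrite mulr_sumr.
rewrite exchange_big; apply: eq_bigr => i _ /=; rewrite mulr_sumr.
by apply: eq_bigr => j _; rewrite mulrCA prRC.
Qed.

Let Bv_e v y : unstarred y -> Bv v (e y) = P y v.
Proof.
move=> uy; rewrite BvC /Bv /P; apply: eq_bigr => i _; congr (_ * _).
by rewrite -/(P (index_gen i) (e y)) P_e // prRC.
Qed.

Definition ext_metric (x y : subvs_of G) : R := Bv (vsval x) (vsval y).

(** The required pairings between h and the starred generators leave no choice: a starred generator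
    is its own pairing, viewed as a form on h. *)
Definition ext_dual (x : gen) : dualv Hh :=
  linfun (fun Y : subvs_of Hh => P x (vsval Y)).

Let B := ext_metric.
Let st := ext_dual.

Let stE x Y : st x Y = P x (vsval Y).
Proof.
by rewrite /st /ext_dual linfunE // => a u v; rewrite [vsval (_ + _)]linearP P_linear.
Qed.

Let g_un x : g x -> unstarred x. Proof. by case/basic_g/andP. Qed.
Let h_un x : h x -> unstarred x. Proof. by case/basic_h/andP. Qed.

Let pG x : g x -> vsval (vsproj G (e x)) = e x.
Proof. by move=> gx; rewrite vsprojK // mem_span_of. Qed.
Let pH x : h x -> vsval (vsproj Hh (e x)) = e x.
Proof. by move=> hx; rewrite vsprojK // mem_span_of. Qed.

Lemma ext_metric_gen x y : g x -> g y ->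
  B (vsproj G (e x)) (vsproj G (e y)) = pr R x y.
Proof. by move=> gx gy; rewrite /B /ext_metric !pG // Bv_e ?P_e ?g_un. Qed.

Let br_gg u v : u \in G -> v \in G -> br u v = 0.
Proof.
move=> uG vG; apply/eqP; rewrite -memv0.
apply: (bracket_span_of lie _ uG vG) => x y gx gy; rewrite memv0; apply/eqP.
by apply: (gcoord_eq basisX) => i; rewrite gcoord0 brC ?g_un // C_gg // rmorph0.
Qed.

Let br_hh : {in Hh & Hh, forall u v, br u v \in Hh}.
Proof.
apply: bracket_span_of => // x y hx hy; apply: (mem_span_of_gcoord basisX) => i hi.
by rewrite brC ?h_un // C_hhg // rmorph0.
Qed.

Let br_hg : {in Hh & G, forall u v, br u v \in G}.
Proof.
apply: bracket_span_of => // x y hx gy; apply: (mem_span_of_gcoord basisX) => i gi.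
by rewrite brC ?(h_un hx) ?(g_un gy) // C_hgh // rmorph0.
Qed.

Let B_nondegenerate u : (forall y, g y -> P y u = 0) -> u \in G -> u = 0.
Proof.
move=> P0 uG; apply: (gcoord_eq basisX) => i; rewrite gcoord0.
case gi: (g (index_gen i)); last by rewrite (gcoord_span_of basisX eG2 eP2 basic_g uG) ?gi.
apply: P_dual0 => cy /(allP (dual_support i)); rewrite gi; exact: P0.
Qed.

Let st_nondegenerate u : (forall y, s y -> P y u = 0) -> u \in Hh -> u = 0.
Proof.
move=> P0 uH; apply: (gcoord_eq basisX) => i; rewrite gcoord0.
have hi := gh (unstarred_bas i).
case gi: (g (index_gen i)); first by rewrite (gcoord_span_of basisX eG2 eP2 basic_h uH) ?hi ?gi.
apply: P_dual0 => cy /(allP (dual_support i)); rewrite gi; exact: P0.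
Qed.

Let Bv_skew y u v : y \in Hh -> u \in G -> v \in G ->
  Bv (br y u) v + Bv u (br y v) = 0.
Proof.
have [lr ll _ _] := lie.
move=> yH uG vG.
pose T y u v : R^o := Bv (br y u) v + Bv u (br y v).
(* Vanishing is phrased as membership in the zero subspace, so that [linear_span_of] reduces the
   three arguments to generators, where [K_skew] applies. *)
suff : T y u v \in 0%VS by rewrite memv0 => /eqP.
have Bl w : linear (Bv ^~ w) by move=> a u1 u2; rewrite !(BvC _ w) Bv_linear.
apply: (linear_span_of (f := T ^~ u ^~ v)) yH => [a y1 y2|z hz].
  by rewrite /T !ll Bl Bv_linear scalerDr addrACA.
apply: (linear_span_of (f := T (e z) ^~ v)) uG => [a u1 u2|x gx].
  by rewrite /T !lr !Bl scalerDr addrACA.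
apply: (linear_span_of (f := T (e z) (e x))) vG => [a v1 v2|x' gx'].
  by rewrite /T !lr !Bv_linear scalerDr addrACA.
rewrite memv0 /T (BvC (e x)) !Bv_e ?g_un // !P_br ?(h_un hz) ?g_un // -rmorphD.
by rewrite (eqP (implyP (K_skew z x x') _)) ?rmorph0 // hz gx gx'.
Qed.

Lemma ext_assumptions : double_extension_assumptions br Hh B.
Proof.
have vP (U : {vspace V}) a (u v : subvs_of U) :
    vsval (a *: u + v) = a *: vsval u + vsval v by exact: linearP.
split=> //.
- split=> //; first by apply: (span_of_direct basisX) => // i; exact/gh/unstarred_bas.
  by move=> u v uG vG; rewrite br_gg ?mem0v.
- split.
  + by move=> x a u v; rewrite /B /ext_metric vP Bv_linear.
  + by move=> x y; exact: BvC.
  + move=> x x0; apply: subvs_inj; rewrite linear0.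
    apply: B_nondegenerate (subvsP x) => y gy.
    by have := x0 (vsproj G (e y)); rewrite /B /ext_metric pG // Bv_e ?g_un.
  move=> x y z; rewrite /B /ext_metric /sub_br !br_gg ?subvsP // !linear0.
  by rewrite (linear_pred0 (Bv_linear _)) BvC (linear_pred0 (Bv_linear _)) addr0.
move=> y x x'; rewrite /B /ext_metric !vsprojK ?br_hg ?subvsP //.
by apply: Bv_skew; exact: subvsP.
Qed.

(** * The extension seen through its metric *)

Let D := dext G Hh.
Let ext : D -> D -> D := dext_br br B.
Let form : D -> D -> R := @dext_form R V G Hh B.
Let f : gen -> D := dext_val e g h s st.

Lemma ext_lie : is_lie ext. Proof. exact: dext_br_lie ext_assumptions. Qed.
Lemma ext_form : invariant_metric ext form.
Proof. exact: dext_form_invariant ext_assumptions. Qed.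

Let exclusive x : in_e x -> [\/ [/\ g x, h x = false & s x = false],
  [/\ g x = false, h x & s x = false] | [/\ g x = false, h x = false & s x]].
Proof.
have := s_starred x; rewrite /in_e.
case gx: (g x); first by rewrite (gh (g_un gx)) gx (g_un gx) implybF => /negPf -> _; apply: Or31.
case hx: (h x); first by rewrite (h_un hx) implybF => /negPf -> _; apply: Or32.
by move=> _ /= ->; apply: Or33.
Qed.

Let dual0 (Y : subvs_of Hh) : (0 : dualv Hh) Y = 0.
Proof. exact: zero_lfunE. Qed.

(** Pairing with a generator of g reads off the g-component, with one of h the dual component, and
    with a starred one the h-component. *)
Let formE (u : D) z : in_e z -> form u (f z) =
  if g z then P z (vsval u.1.1) else
  if h z then u.2 (vsproj Hh (e z)) else P z (vsval u.1.2).
Proof.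
have B0 x : B x 0 = 0 by rewrite /B /ext_metric linear0 (linear_pred0 (Bv_linear _)).
move=> /exclusive; rewrite /form /dext_form /f /dext_val.
case=> -[gz hz sz]; rewrite !(gz, hz, sz) /=.
- by rewrite dual0 linear0 !addr0 /B /ext_metric pG // Bv_e ?g_un.
- by rewrite B0 dual0 !add0r.
by rewrite B0 linear0 addr0 add0r stE.
Qed.

Let form_linear z : linear ((form ^~ (f z)) : D -> R^o).
Proof.
have [l sy _ _] := ext_form.
by move=> a u v; rewrite !(sy _ (f z)); exact: l.
Qed.

(** The reduction behind all bracket computations: an identity in the extension may be tested by
    pairing with generators. *)
Let form_gens u : (forall z, in_e z -> form u (f z) = 0) -> u = 0.
Proof.
case: u => [[u y] phi] u0; congr (_, _, _).
- apply: subvs_inj; rewrite linear0; apply: B_nondegenerate (subvsP _) => z gz.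
  by have := u0 z; rewrite /in_e gz formE /in_e gz //; apply.
- apply: subvs_inj; rewrite linear0; apply: st_nondegenerate (subvsP _) => z sz.
  have iz : in_e z by rewrite /in_e sz !orbT.
  have := u0 z iz; rewrite formE //.
  by case/exclusive: iz => -[gz hz sz']; rewrite sz // in sz'; rewrite gz hz.
apply/lfunP => Y; rewrite dual0 -(vsvalK Y).
suff : (phi (vsproj Hh (vsval Y)) : R^o) \in 0%VS by rewrite memv0 => /eqP.
apply: (linear_span_of (f := fun v => phi (vsproj Hh v) : R^o)) (subvsP Y).
  by move=> a v w; rewrite !linearP.
move=> z hz; have iz : in_e z by rewrite /in_e hz orbT.
have := u0 z iz; rewrite formE // memv0.
by case/exclusive: iz => -[gz hz' sz]; rewrite hz // in hz'; rewrite gz hz => ->.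
Qed.

Lemma ext_form_gen x z : in_e x -> in_e z -> form (f x) (f z) = pr R x z.
Proof.
move=> ix iz; rewrite formE //; have := pr_support x z; rewrite iz /= => sup.
have pr0 : ~~ [|| g x && g z, h x && s z | s x && h z] -> pr R x z = 0.
  move=> /negPf n; move: sup; rewrite n implybF negbK -pr_rat => /eqP ->.
  exact: rmorph0.
move: pr0; rewrite /f /dext_val.
case/exclusive: ix => -[gx hx sx]; rewrite !(gx, hx, sx) /=;
  case/exclusive: iz => -[gz hz sz]; rewrite !(gz, hz, sz) /= => pr0;
  do ?[by rewrite pr0 // ?dual0 ?linear0 ?(linear_pred0 (P_linear _))].
- by rewrite pG // P_e ?g_un.
- by rewrite pH // P_e ?h_un.
by rewrite stE pH // P_e ?h_un // prRC.
Qed.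

Let form_ext u v z : in_e z -> form (ext u v) (f z) =
  if g z then P z (br (vsval u.1.2) (vsval v.1.1)) - P z (br (vsval v.1.2) (vsval u.1.1))
  else if h z then
    Bv (br (e z) (vsval u.1.1)) (vsval v.1.1)
    - v.2 (vsproj Hh (br (vsval u.1.2) (e z))) + u.2 (vsproj Hh (br (vsval v.1.2) (e z)))
  else P z (br (vsval u.1.2) (vsval v.1.2)).
Proof.
move=> iz; rewrite formE // /ext (dext_br3 ext_assumptions) dext_brE.
rewrite double_ext_br1 double_ext_br2.
have vD (a b c : subvs_of G) : vsval (a + b - c) = vsval a + vsval b - vsval c.
  by rewrite !linearD linearN.
have PD a b : P z (a - b) = P z a - P z b.
  by rewrite (linear_predD (P_linear z)) (linear_predN (P_linear z)).
have gg0 (a b : subvs_of G) : vsval (sub_br br a b) = 0.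
  by rewrite /sub_br br_gg ?subvsP // !linear0.
have act_val (a : subvs_of Hh) (b : subvs_of G) :
    vsval (vsproj G (br (vsval a) (vsval b))) = br (vsval a) (vsval b).
  by rewrite vsprojK // br_hg ?subvsP.
case gz: (g z); first by rewrite vD gg0 !act_val add0r PD.
case hz: (h z); last by rewrite /sub_br vsprojK // br_hh ?subvsP.
rewrite /B /ext_metric pH // vsprojK //.
by apply: br_hg (subvsP _); rewrite mem_span_of.
Qed.

Let form_ext_gens x y z : in_e x -> in_e y -> in_e z ->
  form (ext (f x) (f y)) (f z) = ratr (lowered_ext g h s (pr rat) C x y z).
Proof.
have [lr ll _ _] := lie.
have b0 u : br u 0 = 0 by exact: linear_pred0 (lr u).
have b0' u : br 0 u = 0 by exact: linear_pred0 (ll u).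
have P0 w : P w 0 = 0 by exact: linear_pred0 (P_linear w).
have Bv0 u : Bv u 0 = 0 by exact: linear_pred0 (Bv_linear u).
have Bv0' u : Bv 0 u = 0 by rewrite BvC.
have st_br w u v : h u -> h v ->
    st w (vsproj Hh (br (e u) (e v))) = ratr (lowered (pr rat) C u v w).
  by move=> hu hv; rewrite stE vsprojK ?br_hh ?mem_span_of // P_br ?h_un.
move=> ix iy iz; rewrite form_ext //.
case/exclusive: ix => -[gx hx sx]; case/exclusive: iy => -[gy hy sy];
  case/exclusive: iz => -[gz hz sz];
  rewrite /lowered_ext /f /dext_val !(gx, hx, sx, gy, hy, sy, gz, hz, sz) /=;
  rewrite ?(linear0 (vsval _)) ?dual0 ?linear0 ?b0 ?b0' ?P0 ?Bv0 ?Bv0' ?linear0 ?rmorph0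
    ?subr0 ?sub0r ?addr0 ?add0r ?oppr0 //.
all: rewrite ?pG ?pH //.
- by rewrite Bv_e ?(g_un gy) // P_br ?(h_un hz) ?(g_un gx).
- by rewrite rmorphN P_br ?(h_un hy) ?(g_un gx).
- by rewrite P_br ?(h_un hx) ?(g_un gy).
- by rewrite P_br ?(h_un hx) ?(h_un hy).
- by rewrite rmorphN st_br.
by rewrite st_br.
Qed.

(** Paired with z, the left side is a lowered constant. By naturality the right side becomes the
    table with each generator w replaced by <w, z>, first over R and then, through [ratr], over the
    rationals, where [tab_lowered] compares the two. *)
Lemma ext_tabv x y : in_e x -> in_e y ->
  ext (f x) (f y) = table_value (@tab R D f) x y.
Proof.
move=> ix iy; apply/eqP; rewrite -subr_eq0; apply/eqP/form_gens => z iz.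
have fl := form_linear z.
rewrite (linear_predD fl) (linear_predN fl) form_ext_gens //.
(* Naturality asks for this at every name; at a name foreign to the algebra [f] is 0 by default and
   [pr_support] makes the pairing vanish. *)
have fw w : (pr R w z : R^o) = form (f w) (f z).
  case iw: (in_e w); first by rewrite ext_form_gen.
  have -> : f w = 0.
    by rewrite /f /dext_val; move: iw; rewrite /in_e; case: (g w); case: (h w); case: (s w).
  rewrite (linear_pred0 fl) -pr_rat; have := pr_support w z; rewrite iz /=.
  move: iw; rewrite /in_e; case: (g w); case: (h w); case: (s w) => //= _.
  by rewrite implybF negbK => /eqP ->; rewrite rmorph0.
have <- : table_value (@tab R R^o (fun w => pr R w z)) x y =
    form (table_value (@tab R D f) x y) (f z).
  apply: (table_value_natural (sigma := idfun) x y tab_natural (linear_predD fl) _ fw) => a u.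
  exact: (linear_predZ a fl).
rewrite -(eqP (implyP (tab_lowered x y z) _)); last by rewrite ix iy iz.
rewrite (@table_value_natural tab rat R (@ratr R) rat^o R^o (@ratr R) (fun w => pr rat w z)
  (fun w => pr R w z) x y tab_natural) ?subrr //.
- exact: rmorphD.
- by move=> a u; rewrite /GRing.scale /= rmorphM.
Qed.

Lemma ext_brackets : has_brackets ext f in_e (@tab R D f).
Proof. exact: ext_tabv. Qed.

(** A form on h is the sum of its values on the basis times the coordinate forms, and [dual]
    expresses those by starred generators. *)
Lemma ext_dual_span : span_of st s = fullv.
Proof.
apply/eqP; rewrite eqEsubv subvf; apply/subvP=> phi _.
have -> : phi = \sum_(i < 16 | h (index_gen i)) phi (vsproj Hh (e (index_gen i))) *:
    \sum_(cy <- dual i) ratr cy.1 *: st cy.2.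
  apply/lfunP => Y; pose ev (psi : dualv Hh) : R^o := psi Y.
  have evL : linear ev by move=> a u v; rewrite /ev add_lfunE scale_lfunE.
  rewrite -[RHS]/(ev _) (linear_pred_sum evL).
  have phiL : linear (fun v => phi (vsproj Hh v)) by move=> a u v; rewrite !linearP.
  rewrite -[in LHS](vsvalK Y) (gcoord_expand basisX (vsval Y)) (linear_pred_sum phiL).
  rewrite [RHS]big_mkcond; apply: eq_bigr => i _.
  rewrite (linear_predZ _ phiL) (linear_predZ _ evL) (linear_pred_sum evL).
  have -> : \sum_(cy <- dual i) ev (ratr cy.1 *: st cy.2) = gcoord i (vsval Y).
    by rewrite -P_dual; apply: eq_bigr => cy _; rewrite (linear_predZ _ evL) /ev stE.
  case hi: (h (index_gen i)); first exact: mulrC.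
  by rewrite (gcoord_span_of basisX eG2 eP2 basic_h (subvsP Y)) ?hi // scale0r.
apply: memv_suml => i hi; rewrite memvZ // big_seq.
apply: memv_suml => cy cyi; rewrite memvZ // mem_span_of //.
have := allP (dual_support i) _ cyi.
by have := gh (unstarred_bas i); rewrite hi; case: (g (index_gen i)).
Qed.

(** * The Extended Bargmann subalgebra *)

Let E := span_of f gen_ebarg.

Let f_ebarg x : gen_ebarg x -> f x \in E. Proof. exact: mem_span_of. Qed.

Let ext_ebarg x y : gen_ebarg x -> gen_ebarg y ->
  ext (f x) (f y) = table_value (ebarg_table f) x y.
Proof.
by move=> ex ey; rewrite ext_tabv ?tab_ebarg //; exact: implyP (ebarg_in _) _.
Qed.

Let subalgebra_ebarg : subalgebra ext E.
Proof.
apply: (bracket_span_of ext_lie) => x y ex ey.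
by rewrite ext_ebarg // ebarg_table_span.
Qed.

Let dim_ebarg : \dim E = 8%N.
Proof.
pose Y := [tuple f (nth J ebarg_gens i) | i < 8].
have -> : E = <<Y>>%VS.
  apply/eqP; rewrite eqEsubv; apply/andP; split.
    apply: span_of_subv => x /gen_ebargP[i ->].
    by rewrite -(tnth_mktuple (fun i : 'I_8 => f (nth J ebarg_gens i))) memv_span ?mem_tnth.
  by apply/span_subvP=> v /tnthP[i ->]; rewrite tnth_mktuple f_ebarg ?gen_ebarg_nth.
suff : free Y by move/eqP; rewrite size_tuple.
have Yi (i : 'I_8) : Y`_i = f (nth J ebarg_gens i).
  by rewrite -tnth_nth tnth_mktuple.
apply/freeP => k k0 j.
have dj : in_e (nth J ebarg_duals j) by apply: (all_nthP J ebarg_dual_in).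
have fl := form_linear (nth J ebarg_duals j).
(* Pairing the linear relation with the j-th dual generator isolates the j-th coefficient. *)
have := linear_pred0 fl; rewrite -k0 (linear_pred_sum fl) (bigD1 j) //= big1 => [|i ij].
  rewrite addr0 (linear_predZ _ fl) Yi ext_form_gen //; last first.
    exact: implyP (ebarg_in _) (gen_ebarg_nth j).
  by rewrite -pr_rat (eqP (ebarg_dual j j)) eqxx rmorph1 /GRing.scale /= mulr1.
rewrite (linear_predZ _ fl) Yi ext_form_gen //; last first.
  exact: implyP (ebarg_in _) (gen_ebarg_nth i).
by rewrite -pr_rat (eqP (ebarg_dual i j)) (negPf ij) rmorph0 scaler0.
Qed.

Lemma ext_ebarg_subalgebra : extended_bargmann_subalgebra ext f.
Proof.
split=> //; split.
- exact: sub_br_lie ext_lie subalgebra_ebarg.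
- by rewrite dimvf; exact: dim_ebarg.
- apply/eqP; rewrite eqEsubv subvf; apply/subvP=> v _; rewrite -(vsvalK v).
  apply: (linear_span_of (f := vsproj E)) (subvsP v); first by move=> a u w; rewrite linearP.
  by move=> x ex; exact: (@mem_span_of _ _ (fun x => vsproj E (f x)) _ _ ex).
move=> x y ex ey; rewrite /sub_br !vsprojK ?f_ebarg // ext_ebarg //.
(* [vsproj E] is linear, so by naturality it carries the table in the extension to the table in the
   subalgebra. *)
symmetry; have [nat _ _] := tables_natural.
apply: (table_value_natural (sigma := idfun) x y nat) => //.
- exact: linearD.
- by move=> a u; rewrite linearZ.
Qed.

Theorem double_extension_data :
  [/\ forall x y, g x -> g y -> B (vsproj G (e x)) (vsproj G (e y)) = pr R x y,
      double_extension_assumptions br Hh B,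
      span_of st s = fullv
    & [/\ is_lie ext,
          has_brackets ext f in_e (@tab R D f),
          invariant_metric ext form,
          forall x y, in_e x -> in_e y -> form (f x) (f y) = pr R x y
        & extended_bargmann_subalgebra ext f]].
Proof.
split; [exact: ext_metric_gen|exact: ext_assumptions|exact: ext_dual_span|split].
- exact: ext_lie.
- exact: ext_brackets.
- exact: ext_form.
- exact: ext_form_gen.
exact: ext_ebarg_subalgebra.
Qed.

End Extension.

(** * The finite verifications *)

Lemma all_gens_guardedP (P Q : pred gen) : all_gens (fun x => if P x then Q x else true) ->
  forall x, P x -> Q x.
Proof. by move/all_gensP=> PQ x px; have := PQ x; rewrite px. Qed.

(* The guards are tested first so that the structure constants are computed only
   where they matter. *)
Definition closed_constants (C : gen -> gen -> nat -> rat) (p q r : pred gen) :=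
  all_gens (fun x => if p x then
    all_gens (fun y => if q y then
      all (fun i => if r (index_gen i) then true else C x y i == 0) (iota 0 16)
    else true) else true).

Lemma closed_constantsP C p q r : closed_constants C p q r ->
  forall x y (i : 'I_16), p x -> q y -> ~~ r (index_gen i) -> C x y i = 0.
Proof.
move=> /all_gens_guardedP chk x y i /chk /all_gens_guardedP chk2 /chk2 /allP chk3 /negPf ri.
have /chk3 : (i : nat) \in iota 0 16 by rewrite mem_iota /= add0n ltn_ord.
by rewrite ri => /eqP.
Qed.

Definition skew_constants (C : gen -> gen -> nat -> rat) pr (g h : pred gen) :=
  all_gens (fun x => if h x then
    all_gens (fun y => if g y then
      all_gens (fun z => if g z then lowered pr C x y z + lowered pr C x z y == 0 else true)
    else true) else true).

Lemma skew_constantsP C pr g h : skew_constants C pr g h ->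
  forall x y z, [&& h x, g y & g z] ==> (lowered pr C x y z + lowered pr C x z y == 0).
Proof.
move=> /all_gens_guardedP chk x y z; apply/implyP.
case/and3P=> /chk/all_gens_guardedP chk2 /chk2/all_gens_guardedP chk3.
exact: chk3.
Qed.

(** The pairing is summed with [foldr], to which a big operator over a sequence unlocks. *)
Definition dual_basis (pr : gen -> gen -> rat) (g s : pred gen)
    (dual : nat -> seq (rat * gen)) :=
  all (fun i => all (fun cy => if g (index_gen i) then g cy.2 else s cy.2) (dual i) &&
    all (fun j => foldr (fun cy t => cy.1 * pr (index_gen j) cy.2 + t) 0 (dual i)
                  == (i == j)%:R) (iota 0 16)) (iota 0 16).

Lemma dual_basis_support pr g s dual : dual_basis pr g s dual -> forall i : 'I_16,
  all (fun cy => if g (index_gen i) then g cy.2 else s cy.2) (dual i).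
Proof.
move=> /allP chk i; have /chk/andP[] // : (i : nat) \in iota 0 16.
by rewrite mem_iota /= add0n ltn_ord.
Qed.

Lemma dual_basis_pairing pr g s dual : dual_basis pr g s dual -> forall i j : 'I_16,
  \sum_(cy <- dual i) cy.1 * pr (index_gen j) cy.2 == (i == j)%:R.
Proof.
have iota16 (k : 'I_16) : (k : nat) \in iota 0 16 by rewrite mem_iota /= add0n ltn_ord.
move=> /allP chk i j; have /andP[_ /allP chk2] := chk _ (iota16 i).
by have := chk2 _ (iota16 j); rewrite unlock.
Qed.

Definition basic_check (p : pred gen) :=
  all_gens (fun x => if p x then unstarred x && p (index_gen (gen_index x)) else true).

Lemma basicP p : basic_check p -> basic p.
Proof. exact: all_gens_guardedP. Qed.

Definition pairing_check (pr : gen -> gen -> rat) (g h s : pred gen) :=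
  all_gens (fun x => all_gens (fun z => [&& pr x z == pr z x,
    unstarred x ==> (pr x z == pr (index_gen (gen_index x)) z) &
    [|| g z, h z | s z] && (pr x z != 0) ==> [|| g x && g z, h x && s z | s x && h z]])).

(* The basis dual to [index_gen] for the pairing; 1/2 comes from inverting the
   Gram matrix of the components 11 and 22. *)
Definition dual1 (i : nat) : seq (rat * gen) :=
  nth [::] [:: [:: (1, Js)]; [:: (1, P1 o0)]; [:: (1, P1 o1)];
    [:: (1, Hs)]; [:: (1, G1 o0)]; [:: (1, G1 o1)];
    [:: (1, J1s o0)]; [:: (1, J1s o1)];
    [:: (1, P2 o0 o0); (2^-1, P2 o1 o1)]; [:: (1, P2 o0 o1)];
    [:: (2^-1, P2 o0 o0); (1, P2 o1 o1)];
    [:: (1, H1s o0)]; [:: (1, H1s o1)];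
    [:: (1, G2 o0 o0); (2^-1, G2 o1 o1)]; [:: (1, G2 o0 o1)];
    [:: (2^-1, G2 o0 o0); (1, G2 o1 o1)]] i.

(** This tensor pairing has no trace subtraction, so the components 11 and 22 are orthogonal with
    self-pairing 2, whence 1/2; the signs come from <H_a, J_b> = -delta_ab. *)
Definition dual2 (i : nat) : seq (rat * gen) :=
  nth [::] [:: [:: (1, Js)]; [:: (1, P1 o0)]; [:: (1, P1 o1)];
    [:: (1, Hs)]; [:: (1, G1 o0)]; [:: (1, G1 o1)];
    [:: (-1, H1 o0)]; [:: (-1, H1 o1)];
    [:: (2^-1, G2s o0 o0)]; [:: (1, G2s o0 o1)]; [:: (2^-1, G2s o1 o1)];
    [:: (-1, J1 o0)]; [:: (-1, J1 o1)];
    [:: (2^-1, P2s o0 o0)]; [:: (1, P2s o0 o1)]; [:: (2^-1, P2s o1 o1)]] i.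

Section Checks.
Variable c : cosmology.

(** The cosmology stays a variable in the computations below: its sign multiplies only brackets of
    two generators from [i_proc1], which [closed_proc1] never evaluates and [contract_C] discards
    unevaluated. *)
Definition galilean_C := contract_C h_proc1 (hs3_C c).

Lemma closed_proc1 : closed_constants (hs3_C c) h_proc1 h_proc1 h_proc1.
Proof. by vm_compute. Qed.
Lemma closed_proc3 : closed_constants galilean_C h_proc3 h_proc3 h_proc3.
Proof. by vm_compute. Qed.
Lemma closed_proc4 : closed_constants galilean_C h_proc4 h_proc4 h_proc4.
Proof. by vm_compute. Qed.

(** With [xpred0] as target no coordinate is exempt, so the third check says that g is abelian. *)
Lemma checks1 : [&& closed_constants (gal1_C c) h_ebarg1 h_ebarg1 h_ebarg1,
  closed_constants (gal1_C c) h_ebarg1 g_ebarg1 g_ebarg1,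
  closed_constants (gal1_C c) g_ebarg1 g_ebarg1 xpred0,
  skew_constants (gal1_C c) (pairing1 rat) g_ebarg1 h_ebarg1,
  dual_basis (pairing1 rat) g_ebarg1 s_ebarg1 dual1 &
  pairing_check (pairing1 rat) g_ebarg1 h_ebarg1 s_ebarg1].
Proof. by vm_compute. Qed.

Lemma checks2 : [&& closed_constants (gal2_C c) h_ebarg2 h_ebarg2 h_ebarg2,
  closed_constants (gal2_C c) h_ebarg2 g_ebarg2 g_ebarg2,
  closed_constants (gal2_C c) g_ebarg2 g_ebarg2 xpred0,
  skew_constants (gal2_C c) (pairing2 rat) g_ebarg2 h_ebarg2,
  dual_basis (pairing2 rat) g_ebarg2 s_ebarg2 dual2 &
  pairing_check (pairing2 rat) g_ebarg2 h_ebarg2 s_ebarg2].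
Proof. by vm_compute. Qed.

(** The sums in the table are locked big operators. They are opened for each pair of names, and only
    then are the indices enumerated and the two sides computed. *)
Lemma tab1_lowered x y z :
  let in_e x := [|| g_ebarg1 x, h_ebarg1 x | s_ebarg1 x] in
  [&& in_e x, in_e y & in_e z] ==>
  (table_value (@ebarg1_table rat rat^o (fun w => pairing1 rat w z)) x y
     == lowered_ext g_ebarg1 h_ebarg1 s_ebarg1 (pairing1 rat) (gal1_C c) x y z).
Proof.
case: x => [||?|?|?|?|? ?|? ?|||?|?|? ?|? ?]; case: y => [||?|?|?|?|? ?|? ?|||?|?|? ?|? ?];
  rewrite /table_value /ebarg1_table /= ?big_ord2 //; move: z; apply: all_gensP;
  repeat match goal with a : 'I_2 |- _ => move: a; apply: ord2_allP end; by vm_compute.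
Qed.

Lemma tab2_lowered x y z :
  let in_e x := [|| g_ebarg2 x, h_ebarg2 x | s_ebarg2 x] in
  [&& in_e x, in_e y & in_e z] ==>
  (table_value (@ebarg2_table rat rat^o (fun w => pairing2 rat w z)) x y
     == lowered_ext g_ebarg2 h_ebarg2 s_ebarg2 (pairing2 rat) (gal2_C c) x y z).
Proof.
case: x => [||?|?|?|?|? ?|? ?|||?|?|? ?|? ?]; case: y => [||?|?|?|?|? ?|? ?|||?|?|? ?|? ?];
  rewrite /table_value /ebarg2_table /= ?big_ord2 //; move: z; apply: all_gensP;
  repeat match goal with a : 'I_2 |- _ => move: a; apply: ord2_allP end; by vm_compute.
Qed.

End Checks.

Lemma ratr_pairing1 (R : realFieldType) x y : ratr (pairing1 rat x y) = pairing1 R x y.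
Proof.
case: x => [||?|?|?|?|? ?|? ?|||?|?|? ?|? ?]; case: y => [||?|?|?|?|? ?|? ?|||?|?|? ?|? ?];
  rewrite /= /delta_delta /sym ?(rmorph0, rmorph1, rmorph_delta) //.
all: by rewrite rmorphB rmorphD !rmorphM fmorphV /= !rmorph_delta !(@rmorph_nat _ _ ratr).
Qed.

Lemma ratr_pairing2 (R : realFieldType) x y : ratr (pairing2 rat x y) = pairing2 R x y.
Proof.
case: x => [||?|?|?|?|? ?|? ?|||?|?|? ?|? ?]; case: y => [||?|?|?|?|? ?|? ?|||?|?|? ?|? ?];
  rewrite /= /delta_delta /sym ?(rmorph0, rmorph1, rmorphN, rmorph_delta) //.
all: by rewrite !(rmorphD, rmorphM, rmorph_delta).
Qed.

Lemma ebarg1_gram (i j : 'I_8) :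
  pairing1 rat (nth J ebarg_gens i) (nth J ebarg_duals j) == (i == j)%:R.
Proof. by case: i; do 8?[case=> [|] //=]; case: j; do 8?[case=> [|] //=]. Qed.

Lemma ebarg2_gram (i j : 'I_8) :
  pairing2 rat (nth J ebarg_gens i) (nth J ebarg_duals j) == (i == j)%:R.
Proof. by case: i; do 8?[case=> [|] //=]; case: j; do 8?[case=> [|] //=]. Qed.

Lemma unstarred_compl (p q : pred gen) :
  all_gens (fun x => if unstarred x then q x == ~~ p x else true) ->
  forall x, unstarred x -> q x = ~~ p x.
Proof. by move=> /all_gens_guardedP pq x /pq /eqP. Qed.

Lemma ebarg1_tabE (F : fieldType) (W : lmodType F) (f : gen -> W) x y :
  gen_ebarg x -> gen_ebarg y -> table_value (ebarg1_table f) x y = table_value (ebarg_table f) x y.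
Proof. by case: x => //; case: y. Qed.

(** The second table lists [G_a, P_b] where the Bargmann table lists [P_a, G_b]; the two agree
    because reversing the bracket and exchanging the indices of epsilon each give a sign. *)
Lemma ebarg2_tabE (F : fieldType) (W : lmodType F) (f : gen -> W) x y :
  gen_ebarg x -> gen_ebarg y -> table_value (ebarg2_table f) x y = table_value (ebarg_table f) x y.
Proof.
case: x => //; case: y => //= b a _ _; rewrite /table_value /=.
all: by elim/ord2_ind: a; elim/ord2_ind: b; rewrite /eps /eps3 /= -?scaleNr ?opprK ?oppr0.
Qed.

Theorem mainTheorem3 (R : realType) (c : cosmology) (V : vectType R)
    (br : V -> V -> V) (hat : hatted_generators V) (hhs3 : is_hs3 c br hat) :
  let e := gen_val hat in
  let br1 := contraction br (span_of e h_proc1) (span_of e i_proc1) in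
  let gal1 := contraction br1 (span_of e h_proc3) (span_of e i_proc3) in
  let gal2 := contraction br1 (span_of e h_proc4) (span_of e i_proc4) in
  [/\ contractible br (span_of e h_proc1) (span_of e i_proc1),
      contractible br1 (span_of e h_proc3) (span_of e i_proc3)
    & contractible br1 (span_of e h_proc4) (span_of e i_proc4)]
  /\ (let g := span_of e g_ebarg1 in
      let h := span_of e h_ebarg1 in
      let in_ebarg1 : pred gen :=
        fun x => [|| g_ebarg1 x, h_ebarg1 x | s_ebarg1 x] in
      exists (B : subvs_of g -> subvs_of g -> R) (st : gen -> dualv h),
      let ebarg1 : dext g h -> dext g h -> dext g h := dext_br gal1 B in
      let metric : dext g h -> dext g h -> R := dext_form B in
      let f : gen -> dext g h := dext_val e g_ebarg1 h_ebarg1 s_ebarg1 st in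
      [/\ forall x y, g_ebarg1 x -> g_ebarg1 y ->
            B (vsproj g (e x)) (vsproj g (e y)) = pairing1 R x y,
          double_extension_assumptions gal1 h B,
          span_of st s_ebarg1 = fullv
        & [/\ is_lie ebarg1,
              has_brackets ebarg1 f in_ebarg1 (ebarg1_table f),
              invariant_metric ebarg1 metric,
              forall x y, in_ebarg1 x -> in_ebarg1 y ->
                metric (f x) (f y) = pairing1 R x y
            & extended_bargmann_subalgebra ebarg1 f]])
  /\ (let g := span_of e g_ebarg2 in
      let h := span_of e h_ebarg2 in
      let in_ebarg2 : pred gen :=
        fun x => [|| g_ebarg2 x, h_ebarg2 x | s_ebarg2 x] in
      exists (B : subvs_of g -> subvs_of g -> R) (st : gen -> dualv h),
      let ebarg2 : dext g h -> dext g h -> dext g h := dext_br gal2 B in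
      let metric : dext g h -> dext g h -> R := dext_form B in
      let f : gen -> dext g h := dext_val e g_ebarg2 h_ebarg2 s_ebarg2 st in
      [/\ forall x y, g_ebarg2 x -> g_ebarg2 y ->
            B (vsproj g (e x)) (vsproj g (e y)) = pairing2 R x y,
          double_extension_assumptions gal2 h B,
          span_of st s_ebarg2 = fullv
        & [/\ is_lie ebarg2,
              has_brackets ebarg2 f in_ebarg2 (ebarg2_table f),
              invariant_metric ebarg2 metric,
              forall x y, in_ebarg2 x -> in_ebarg2 y ->
                metric (f x) (f y) = pairing2 R x y
            & extended_bargmann_subalgebra ebarg2 f]]).

Proof.
move=> e br1 gal1 gal2.
have bX : basis_of fullv [tuple e (index_gen i) | i < 16] := basis_gen_val hhs3.
have eG a b : e (G2 a b) = e (G2 b a) := gen_val_G2C hhs3 a b.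
have eP a b : e (P2 a b) = e (P2 b a) := gen_val_P2C hhs3 a b.
have b1h : basic h_proc1 by apply: basicP.
have b1i : basic i_proc1 by apply: basicP.
have b3h : basic h_proc3 by apply: basicP.
have b3i : basic i_proc3 by apply: basicP.
have b4h : basic h_proc4 by apply: basicP.
have b4i : basic i_proc4 by apply: basicP.
have c1 x : unstarred x -> i_proc1 x = ~~ h_proc1 x by move: x; apply: unstarred_compl.
have c3 x : unstarred x -> i_proc3 x = ~~ h_proc3 x by move: x; apply: unstarred_compl.
have c4 x : unstarred x -> i_proc4 x = ~~ h_proc4 x by move: x; apply: unstarred_compl.
have lie := hs3_lie hhs3.
have k0 := hs3_constants hhs3.
have d1 : contractible br (span_of e h_proc1) (span_of e i_proc1).
  apply: (span_of_contractible bX eG eP lie k0) => //.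
  exact/closed_constantsP/closed_proc1.
have lie1 : is_lie br1 := contraction_lie lie d1.
have k1 : structure_constants e br1 (galilean_C c) by exact: contraction_constants.
have d3 : contractible br1 (span_of e h_proc3) (span_of e i_proc3).
  apply: (span_of_contractible bX eG eP lie1 k1) => //.
  exact/closed_constantsP/closed_proc3.
have d4 : contractible br1 (span_of e h_proc4) (span_of e i_proc4).
  apply: (span_of_contractible bX eG eP lie1 k1) => //.
  exact/closed_constantsP/closed_proc4.
have lie3 : is_lie gal1 := contraction_lie lie1 d3.
have lie4 : is_lie gal2 := contraction_lie lie1 d4.
have k3 : structure_constants e gal1 (gal1_C c) by exact: contraction_constants.
have k4 : structure_constants e gal2 (gal2_C c) by exact: contraction_constants.
have [_ nat1 nat2] := tables_natural.
split; [by split | split].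
- have /and5P[hh hg gg sk /andP[du pa]] := checks1 c.
  exists (@ext_metric R V e g_ebarg1 pairing1), (@ext_dual R V e h_ebarg1 pairing1).
  apply: (@double_extension_data R V e bX eG eP gal1 (gal1_C c) lie3 k3
    g_ebarg1 h_ebarg1 s_ebarg1 pairing1 dual1 (@ebarg1_table)).
  (* The complement in procedure 3 is the g of the extension and its subalgebra is the h; the
     predicates are convertible. *)
  + exact: b3i.
  + exact: b3h.
  + by apply: unstarred_compl.
  + by apply: all_gensP.
  + exact: ratr_pairing1.
  + by move=> x y; case/and3P: (all_gens2P pa x y).
  + by move=> x y; case/and3P: (all_gens2P pa x y).
  + by move=> x y; case/and3P: (all_gens2P pa x y).
  + exact: dual_basis_support du.
  + exact: dual_basis_pairing du.
  + exact: closed_constantsP hh.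
  + exact: closed_constantsP hg.
  + by move=> x y i gx gy; apply: (closed_constantsP gg).
  + exact: skew_constantsP sk.
  + exact: nat1.
  + exact: tab1_lowered.
  + exact: ebarg1_tabE.
  + by apply: all_gensP.
  + exact: ebarg1_gram.
  + by [].
have /and5P[hh hg gg sk /andP[du pa]] := checks2 c.
exists (@ext_metric R V e g_ebarg2 pairing2), (@ext_dual R V e h_ebarg2 pairing2).
apply: (@double_extension_data R V e bX eG eP gal2 (gal2_C c) lie4 k4
  g_ebarg2 h_ebarg2 s_ebarg2 pairing2 dual2 (@ebarg2_table)).
- exact: b4i.
- exact: b4h.
- by apply: unstarred_compl.
- by apply: all_gensP.
- exact: ratr_pairing2.
- by move=> x y; case/and3P: (all_gens2P pa x y).
- by move=> x y; case/and3P: (all_gens2P pa x y).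
- by move=> x y; case/and3P: (all_gens2P pa x y).
- exact: dual_basis_support du.
- exact: dual_basis_pairing du.
- exact: closed_constantsP hh.
- exact: closed_constantsP hg.
- by move=> x y i gx gy; apply: (closed_constantsP gg).
- exact: skew_constantsP sk.
- exact: nat2.
- exact: tab2_lowered.
- exact: ebarg2_tabE.
- by apply: all_gensP.
- exact: ebarg2_gram.
- by [].
Qed.
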